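(* Let $(\Lambda_n)_{n\ge0}$ be a Markov chain on $E$ with initial law $\zeta$ and transition kernels $Q_n$ such that, for each $n\ge1$, there is $\varepsilon_n\in(0,1)$ with $\varepsilon_n\xi(A)\le Q_n(\lambda,A)\le\varepsilon_n^{-1}\xi(A)$ for some nonnegative measure $\xi$ on $E$ and all Borel $A\subset E$, $\lambda\in E$. Let $h,v,w$ be real-valued functions on $E$ with $0<\underline v\le v(\lambda)\le\bar v$, $0<\underline w\le w(\lambda)\le\bar w$ and $|h(\lambda)|\le\bar h<1$ for all $\lambda\in E$. Consider the mixture Kalman model: conditional on $(\Lambda_n)$, $X_0=0$ almost surely and, for $n\ge1$, $$X_n=h(\Lambda_n)X_{n-1}+\sqrt{w(\Lambda_n)}\,W_n,\qquad Y_n=X_n+\sqrt{v(\Lambda_n)}\,V_n,$$ with $V_n,W_n$ independent $\mathcal N(0,1)$ variables, and let $\Psi_n(\lambda_{0:n})$ be the conditional density of $Y_n$ at $y_n$ given $\Lambda_{0:n}=\lambda_{0:n}$, $Y_{1:n-1}=y_{1:n-1}$. Set $$\underline\sigma^2=\underline v+\underline w,\quad\bar\sigma^2=(\bar h^2+1)\bar v+\bar w,\quad \bar a=1-\frac{\underline v}{\bar h^2\bar v+\bar w+\underline v},\quad\tilde a=\frac{\bar v}{\bar v+\underline w},$$ $$\tau_\sigma=\frac{1}{1+\underline w/\bar v+2\sqrt{\underline w/\bar v+\underline w^2/\bar v^2}}<1,\qquad \tau=\bar h\vee\tau_\sigma .$$ Suppose the realizations are bounded, $|y_n|\le C_y$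 for all $n\ge1$, let $$c=\frac{\bar\sigma}{\underline\sigma}\exp\left[\frac{C_y^2}{\underline\sigma^2}\left\{1+\left(\frac{\bar a\bar h}{1-\tilde a\bar h}\right)^2\right\}\right],$$ and suppose $\tau c^3<1$. Then the particle error is bounded uniformly in time, i.e. there exist constants $C$, $D$ (not depending on $n$ or $N$) such that, almost surely, $$\mathcal{E}_{n,N}^{p}(y_{1:n})\leq C\left\{ \log(N)+D\right\} \left(\frac{1}{\sqrt{N}}\right)^{1+3\log c/\log\tau},\qquad\text{for } p=\left\lceil \frac{\log\left\{ \frac{4c}{3\phi\sqrt{N}}\right\}}{\log\tau}\right\rceil ,$$ where $N$ is the number of particles, and the particle error $\mathcal{E}_{n,N}^{p}$ and the constant $\phi$ are defined in the context.
   Context: $E$ is a complete separable metric space with its Borel $\sigma$-field; $v_{i:j}=(v_i,\ldots,v_j)$; $\langle\mu,f\rangle=\mu(f)=\int f\,d\mu$. By the Kalman-Bucy filter, $\Psi_n(\lambda_{0:n})=\frac{1}{\sqrt{2\pi\sigma_n^2(\lambda_{0:n})}}\exp\left[-\frac{\{y_n-\mu_n(\lambda_{0:n})\}^2}{2\sigma_n^2(\lambda_{0:n})}\right]$, where $m_0=c_0=0$ and, for $n\ge1$ (arguments $\lambda_{0:n}$ or $\lambda_{0:n-1}$ omitted): $\mu_n=h(\lambda_n)m_{n-1}$, $\sigma_n^2=h(\lambda_n)^2c_{n-1}+v(\lambda_n)+w(\lambda_n)$, $a_n=\{h(\lambda_n)^2c_{n-1}+w(\lambda_n)\}/\sigma_n^2$,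 $m_n=h(\lambda_n)m_{n-1}+a_n(y_n-\mu_n)$, $c_n=h(\lambda_n)^2c_{n-1}+w(\lambda_n)-a_n^2\sigma_n^2$. The constant $\phi$: let $C_\sigma=\bar h^2\bar v/\tau_\sigma$, and let $C_\mu>0$ be a constant such that $|\mu_n(\lambda_{0:n})-\mu_n(\lambda'_{0:n})|\le C_\mu\max_{1\le i\le n-1}|y_i|\,\tau^k$ for all $k\ge1$, $n\ge k$ and all $\lambda_{0:n},\lambda'_{0:n}$ with $\lambda_{n-k+1:n}=\lambda'_{n-k+1:n}$. Then $$\phi=\exp\left\{ \frac{C_{\sigma}}{2\underline{\sigma}^{2}}+\frac{C_{\mu}C_{y}^{2}}{\underline{\sigma}^{2}}\left(1+\frac{\bar{a}\bar{h}}{1-\tilde{a}\bar{h}}\right)+\frac{C_{y}^{2}C_{\sigma}}{\underline{\sigma}^{4}}\left[1+\left(\frac{\bar{a}\bar{h}}{1-\tilde{a}\bar{h}}\right)^{2}\right]\right\} -1.$$ Given kernels $Q_n$ and potentials $\Psi_n$, for a measure $\mu$ on $E^n$ let $\gamma_n\mu(f)=\int\mu(d\lambda_{0:n-1})Q_n(\lambda_{n-1},d\lambda_n)\Psi_n(\lambda_{0:n})f(\lambda_{0:n})$, $R_n\mu(f)=\gamma_n\mu(f)/\gamma_n\mu(1)$, and $R_{1:n}\zeta=R_n\cdots R_1\zeta$. $H_n^p$ maps a measure on $E^{n+1}$ to its marginal on the last $p$ components $\lambda_{n-p+1:n}$ if $n\ge p$, and is the identity if $p>n$. Particle operators: for a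 probability measure $\mu'$, $S^N(\mu')=\frac1N\sum_{i=1}^N\delta_{Z_i}$ with $Z_1,\dots,Z_N$ i.i.d. of law $\mu'$. Let $\bar Q_n(\lambda_{0:n-1},d\lambda_{0:n}')=\delta_{\lambda_{0:n-1}}(d\lambda'_{0:n-1})Q_n(\lambda_{n-1},d\lambda_n')$ and $\Psi_n\cdot\nu(f)=\nu(\Psi_nf)/\nu(\Psi_n)$. For a probability measure $\mu$ on $E^n$, $R_n^N\mu=\Psi_n\cdot S^N(\bar Q_n\mu)$, and $R_{1:n}^N\zeta=R_n^N\cdots R_1^N\zeta$, with samples drawn afresh at each step. Particle error: $\mathcal{E}_{n,N}^{p}(y_{1:n})=\sup_{f:\Vert f\Vert_{\infty}=1}\mathbb{E}_{N}\left(\left|\langle H_{n}^{p}R_{1:n}\zeta-H_{n}^{p}R_{1:n}^{N}\zeta,f\rangle\right|\right)$, the supremum being over functions $f:E^{(n+1)\wedge p}\to\mathbb R$ and $\mathbb E_N$ being the expectation over the randomness of the $N$ particles only, for fixed $y_{1:n}$.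
   Formalization: The mixing constants ε_n are additionally assumed bounded below by some ε>0 for all n≥1; without this the time-uniform bound fails, e.g. for a two-state chain flipping with probability ε_n=2^{-(n+1)} and potentials that do not depend on λ. *)

(* Defs.v *)
From HB Require Import structures.
From mathcomp Require Import all_boot all_order all_algebra.
From mathcomp Require Import all_classical all_reals all_analysis.

Unset Printing Implicit Defensive.

Import Order.TTheory GRing.Theory Num.Theory.
Import numFieldNormedType.Exports.

Local Open Scope classical_set_scope.
Local Open Scope ring_scope.

#[short(type="completeMetricType")]
HB.structure Definition CompleteMetric (R : numDomainType) :=
  {T of Complete T & Metric R T}.

Definition separable (T : topologicalType) :=
  exists S : set T, countable S /\ dense S.

Notation borel E := (g_sigma_algebraType (@open E)).

(* Measures that are built from one another are set functions
   [set T -> \bar R]; the library integral is defined for those, and nothing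
   has to be proved to write them down. *)
Section FeynmanKac.
Context {R : realType} {d : measure_display} {E : measurableType d}.
Local Open Scope ereal_scope.

Definition sup_norm {T : Type} (f : T -> R) : \bar R :=
  ereal_sup [set `|f x|%:E | x in [set: T]].

Definition extend {n} (l : n.+1.-tuple E) (x : E) : n.+2.-tuple E :=
  [tuple of rcons l x].

Definition endpoint {n} (l : n.+1.-tuple E) : E := tnth l ord_max.

(* The coordinates n - p + 1, ..., n of a path indexed by 0, ..., n; the whole
   path if p > n. *)
Definition last_coords p {n} (l : n.+1.-tuple E) : (minn n.+1 p).-tuple E :=
  [tuple tnth l (inord (n.+1 - p + i)) | i < minn n.+1 p].

Definition marginal p {n} (mu : set (n.+1.-tuple E) -> \bar R) :
    set ((minn n.+1 p).-tuple E) -> \bar R :=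
  pushforward mu (last_coords p).

Variables (zeta : set E -> \bar R) (Q : nat -> E -> {measure set E -> \bar R}).
Variable Psi : forall n, n.+1.-tuple E -> R.

Definition initial_law : set (1.-tuple E) -> \bar R :=
  pushforward zeta (fun x => [tuple x]).

(* [gammaop n] and [Rop n] are the operators of step n.+1, from measures on
   paths 0, ..., n to measures on paths 0, ..., n.+1. *)
Definition gammaop {n} (mu : set (n.+1.-tuple E) -> \bar R)
    (A : set (n.+2.-tuple E)) : \bar R :=
  \int[mu]_l \int[Q n.+1 (endpoint l)]_x
    (Psi n.+1 (extend l x) * \1_A (extend l x))%:E.

Definition Rop {n} (mu : set (n.+1.-tuple E) -> \bar R)
    (A : set (n.+2.-tuple E)) : \bar R :=
  (fine (gammaop mu setT))^-1%:E * gammaop mu A.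

Fixpoint Rflow n : set (n.+1.-tuple E) -> \bar R :=
  if n is m.+1 then Rop (Rflow m) else initial_law.

Definition Qbar {n} (l : n.+1.-tuple E) : set (n.+2.-tuple E) -> \bar R :=
  pushforward (Q n.+1 (endpoint l)) (extend l).

Definition Qbar_act {n} (mu : set (n.+1.-tuple E) -> \bar R)
    (A : set (n.+2.-tuple E)) : \bar R :=
  \int[mu]_l Qbar l A.

(* [gibbs Psi nu] is written Psi . nu in the literature. *)
Definition gibbs {d'} {T : measurableType d'} (g : T -> R) (nu : set T -> \bar R)
    (A : set T) : \bar R :=
  (fine (\int[nu]_x (g x)%:E))^-1%:E * \int[nu]_(x in A) (g x)%:E.

Definition empirical {d'} {T : measurableType d'} {N} (z : N.-tuple T)
    (A : set T) : \bar R :=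
  (N%:R^-1)%:E * \sum_(i < N) \d_(tnth z i) A.

(* The N-fold product measure of nu, the joint law of N i.i.d. draws. *)
Fixpoint iid_law N {d'} {T : measurableType d'} (nu : set T -> \bar R) :
    set (N.-tuple T) -> \bar R :=
  if N is M.+1
  then fun A => \int[nu]_x iid_law M nu [set t : M.-tuple T | A (cons_tuple x t)]
  else \d_([tuple]).

(* [expect_particles N F] is the expectation of F at the random measure
   obtained from [zeta] by n steps of the N-particle algorithm: the last step
   maps the current measure mu to the Gibbs transform of the empirical measure
   of N draws from [Qbar_act mu], and these are independent of the previous
   steps given mu. *)
Fixpoint expect_particles N n :
    ((set (n.+1.-tuple E) -> \bar R) -> \bar R) -> \bar R :=
  if n is m.+1
  then fun F => expect_particles N m (fun mu : set (m.+1.-tuple E) -> \bar R =>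
    \int[iid_law N (Qbar_act mu)]_z F (gibbs (Psi m.+1) (empirical z)))
  else fun F => F initial_law.

Definition particle_error N n p : \bar R :=
  ereal_sup [set expect_particles N n (fun mu =>
      `| \int[marginal p (Rflow n)]_x (f x)%:E
         - \int[marginal p mu]_x (f x)%:E |)
    | f in [set f : {mfun (minn n.+1 p).-tuple E >-> R} | sup_norm f = 1]].

End FeynmanKac.

(* The state space model X_n = h(l_n) X_(n-1) + sqrt(w(l_n)) W_n,
   Y_n = X_n + sqrt(v(l_n)) V_n with X_0 = 0, for a frozen trajectory
   l : nat -> E of the chain; y n is the value of Y_n for n >= 1. *)
Section MixtureKalman.
Context {R : realType} {E : Type}.
Variables (h v w : E -> R) (y : nat -> R) (l : nat -> E).

(* Density of (Y_1, ..., Y_n, X_n.+1) at (y_1, ..., y_n, x). *)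
Fixpoint prediction_density (n : nat) (x : R) : R :=
  if n is m.+1 then
    (\int[@lebesgue_measure R]_z
      (prediction_density m z * normal_pdf z (Num.sqrt (v (l m.+1))) (y m.+1)
       * normal_pdf (h (l m.+2) * z) (Num.sqrt (w (l m.+2))) x))%R
  else normal_pdf (h (l 1%N) * 0) (Num.sqrt (w (l 1%N))) x.

(* Density of (Y_1, ..., Y_n) at (y_1, ..., y_n). *)
Definition observation_density (n : nat) : R :=
  if n is m.+1 then
    (\int[@lebesgue_measure R]_z
      (prediction_density m z
       * normal_pdf z (Num.sqrt (v (l m.+1))) (y m.+1)))%R
  else 1.

(* Kalman filter: [kalman_m n], [kalman_c n] are m_n, c_n; [kalman_mu n],
   [kalman_sigma2 n], [kalman_a n] are mu_n, sigma_n^2, a_n, for n >= 1. *)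
Definition sigma2_step (c : R) (n : nat) : R :=
  h (l n) ^+ 2 * c + v (l n) + w (l n).

Definition a_step (c : R) (n : nat) : R :=
  (h (l n) ^+ 2 * c + w (l n)) / sigma2_step c n.

Fixpoint kalman_c (n : nat) : R :=
  if n is k.+1 then
    h (l n) ^+ 2 * kalman_c k + w (l n)
    - a_step (kalman_c k) n ^+ 2 * sigma2_step (kalman_c k) n
  else 0.

Definition kalman_sigma2 (n : nat) : R := sigma2_step (kalman_c n.-1) n.

Definition kalman_a (n : nat) : R := a_step (kalman_c n.-1) n.

Fixpoint kalman_m (n : nat) : R :=
  if n is k.+1 then
    h (l n) * kalman_m k + kalman_a n * (y n - h (l n) * kalman_m k)
  else 0.

Definition kalman_mu (n : nat) : R := h (l n) * kalman_m n.-1.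

End MixtureKalman.

(* Conditional density of Y_n at y_n given the path and Y_i = y_i for i < n,
   as a ratio of joint densities. The path is read as a trajectory, whose
   values beyond n are irrelevant. *)
Definition potential {R : realType} {E : Type} (h v w : E -> R) (y : nat -> R)
    (n : nat) (t : n.+1.-tuple E) : R :=
  let l := nth (thead t) t in
  observation_density h v w y l n / observation_density h v w y l n.-1.

Section Constants.
Context {R : realType}.
Variables hbar vlow vbar wlow wbar Cy Cmu : R.

(* sigma_low, sigma_bar are standard deviations. *)
Definition sigma_low : R := Num.sqrt (vlow + wlow).
Definition sigma_bar : R := Num.sqrt ((hbar ^+ 2 + 1) * vbar + wbar).
Definition a_bar : R := 1 - vlow / (hbar ^+ 2 * vbar + wbar + vlow).
Definition a_tilde : R := vbar / (vbar + wlow).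
Definition tau_sigma : R :=
  1 / (1 + wlow / vbar
       + 2 * Num.sqrt (wlow / vbar + wlow ^+ 2 / vbar ^+ 2)).
Definition tau : R := Num.max hbar tau_sigma.
Definition C_sigma : R := hbar ^+ 2 * vbar / tau_sigma.
Definition a_ratio : R := a_bar * hbar / (1 - a_tilde * hbar).

Definition c_const : R :=
  sigma_bar / sigma_low
  * expR (Cy ^+ 2 / sigma_low ^+ 2 * (1 + a_ratio ^+ 2)).

Definition phi : R :=
  expR (C_sigma / (2 * sigma_low ^+ 2)
        + Cmu * Cy ^+ 2 / sigma_low ^+ 2 * (1 + a_ratio)
        + Cy ^+ 2 * C_sigma / sigma_low ^+ 4 * (1 + a_ratio ^+ 2)) - 1.

(* Zero if the ceiling is negative. *)
Definition lag (N : nat) : nat :=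
  absz (Num.max 0 (Num.ceil
    (ln (4 * c_const / (3 * phi * Num.sqrt N%:R)) / ln tau))).

End Constants.

(* Main.v *)
Require Import Defs.
From HB Require Import structures.
From mathcomp Require Import all_boot all_order all_algebra.
From mathcomp Require Import all_classical all_reals all_analysis.
From mathcomp Require Import measurable_realfun ring lra zify.

(* Changing the past of a path from which the last j coordinates are kept
   multiplies the potential Psi by at most exp (K tau^j); the product of these
   factors along the future stays bounded, so that, after one mixing transition,
   the Feynman-Kac laws of the future started from any two pasts are comparable
   up to a uniform constant. Hence R_{k+1:n} forgets its initial law: on functions
   of the last p coordinates its oscillation decays like (n - k - p)^-2, which is
   summable. A second moment bound makes the error introduced by one resampling
   step of order 1 / sqrt N. Replacing the particle steps one by one by exact steps
   gives an error at most C (p + D) / sqrt N uniformly in n, without truncating the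
   potentials. Since c >= 1 and tau < 1, the exponent of 1 / sqrt N in the claim is
   at most 1, and p grows like log N. *)

Import Order.TTheory GRing.Theory Num.Theory.
Import numFieldNormedType.Exports.

Local Open Scope classical_set_scope.
Local Open Scope ring_scope.

(** * Bounded measurable functions and represented set functions *)

(** A potential sees the whole past, so the chain weighted by the potentials is not Markov in its
    last coordinate. Giving the same m new coordinates to two pasts costs one mixing factor, and
    what is left of the two pasts afterwards is of order tau^m. The oscillation is thus bounded by
    any sequence b with b(L) >= (1 - delta) b(L - m) + eta tau^m for some m <= L. With m a fixed
    fraction of L, a multiple of the inverse square is such a sequence. Forgetting helps only if the
    sampling error of a step is proportional to the oscillation of what remains to be computed;
    hence the estimate for ratios of sums, whose numerator is centred before second moments are
    taken. Expectations over particles are iterated integrals, against bare set functions, of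
    functionals not known to be measurable. They are handled by monotonicity alone: one particle
    step sends a functional a |V - value| + C below another of the same form, so that the steps are
    replaced by induction. *)

Section BoundedMeasurable.
Context {d} {T : measurableType d} {R : realType}.
Implicit Types f g : T -> R.

Definition bdd_mfun f := measurable_fun setT f /\ exists M, forall x, `|f x| <= M.

Lemma bdd_mfun_cst r : bdd_mfun (fun=> r).
Proof. by split => //; exists `|r|. Qed.

Lemma bdd_mfunD f g : bdd_mfun f -> bdd_mfun g -> bdd_mfun (fun x => f x + g x).
Proof.
move=> [mf [M fM]] [mg [K gK]]; split; first exact: measurable_funD.
by exists (M + K) => x; rewrite (le_trans (ler_normD _ _))// lerD.
Qed.

Lemma bdd_mfunM f g : bdd_mfun f -> bdd_mfun g -> bdd_mfun (fun x => f x * g x).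
Proof.
move=> [mf [M fM]] [mg [K gK]]; split; first exact: measurable_funM.
by exists (M * K) => x; rewrite normrM ler_pM.
Qed.

Lemma bdd_mfunZ r f : bdd_mfun f -> bdd_mfun (fun x => r * f x).
Proof. by move=> ?; apply: bdd_mfunM => //; exact: bdd_mfun_cst. Qed.

Lemma bdd_mfunB f g : bdd_mfun f -> bdd_mfun g -> bdd_mfun (fun x => f x - g x).
Proof.
move=> mf mg.
have -> : (fun x => f x - g x) = (fun x => f x + (-1) * g x).
  by apply/funext => x; rewrite mulN1r.
by apply: bdd_mfunD => //; exact: bdd_mfunZ.
Qed.

Lemma bdd_mfun_sum I (s : seq I) (F : I -> T -> R) :
  (forall i, bdd_mfun (F i)) -> bdd_mfun (fun x => \sum_(i <- s) F i x).
Proof.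
move=> mF; elim: s => [|i s IH].
  under eq_fun do rewrite big_nil; exact: bdd_mfun_cst.
by under eq_fun do rewrite big_cons; exact: bdd_mfunD.
Qed.

Lemma bdd_mfun_norm f : bdd_mfun f -> bdd_mfun (fun x => `|f x|).
Proof.
move=> [mf [M fM]]; split; first exact: measurableT_comp.
by exists M => x; rewrite normr_id.
Qed.

Lemma bdd_mfunV (a : R) f : 0 < a -> (forall x, a <= f x) -> bdd_mfun f ->
  bdd_mfun (fun x => (f x)^-1).
Proof.
move=> a0 af [mf _]; split.
  (* Since [f] is positive, its inverse is a real power, and powers are measurable. *)
  have -> : (fun x => (f x)^-1) = (fun x => f x `^ (-1)).
    by apply/funext => x; rewrite powRN powRr1// (le_trans (ltW a0)).
  apply: (@measurableT_comp _ _ _ _ _ _ (@powR R ^~ (-1)) _ f).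
    exact: measurable_powR.
  exact: mf.
exists a^-1 => x; rewrite ger0_norm ?invr_ge0 ?(le_trans (ltW a0))//.
by rewrite lef_pV2// posrE// (lt_le_trans a0).
Qed.

Lemma bdd_mfun_integrable (mu : {finite_measure set T -> \bar R}) f :
  bdd_mfun f -> mu.-integrable setT (EFin \o f).
Proof.
move=> [mf [M fM]]; apply: measurable_bounded_integrable => //.
  by rewrite ltey_eq fin_num_measure.
exists `|M|; split; first exact: normr_real.
by move=> r Mr x _ /=; rewrite (le_trans (fM x))// (le_trans (ler_norm M))// ltW.
Qed.

Variable P : probability T R.

Lemma probability_Rintegral_cst r : \int[P]_x r = r.
Proof.
rewrite Rintegral_cst// -[RHS]mulr1; congr (_ * _).
exact: (congr1 fine (probability_setT P)).
Qed.

Lemma bdd_mfun_EFin f : bdd_mfun f ->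
  (\int[P]_x (f x)%:E)%E = (\int[P]_x f x)%:E.
Proof.
move=> bf; rewrite /Rintegral fineK//; apply: integrable_fin_num => //.
exact: bdd_mfun_integrable.
Qed.

Lemma RintegralD_bdd f g : bdd_mfun f -> bdd_mfun g ->
  \int[P]_x (f x + g x) = \int[P]_x f x + \int[P]_x g x.
Proof. by move=> ? ?; rewrite RintegralD//; exact: bdd_mfun_integrable. Qed.

Lemma RintegralB_bdd f g : bdd_mfun f -> bdd_mfun g ->
  \int[P]_x (f x - g x) = \int[P]_x f x - \int[P]_x g x.
Proof. by move=> ? ?; rewrite RintegralB//; exact: bdd_mfun_integrable. Qed.

Lemma RintegralZ_bdd r f : bdd_mfun f ->
  \int[P]_x (r * f x) = r * \int[P]_x f x.
Proof. by move=> ?; rewrite RintegralZl//; exact: bdd_mfun_integrable. Qed.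

Lemma le_Rintegral_bdd f g : bdd_mfun f -> bdd_mfun g ->
  (forall x, f x <= g x) -> \int[P]_x f x <= \int[P]_x g x.
Proof.
by move=> ? ? fg; apply: le_Rintegral => //; exact: bdd_mfun_integrable.
Qed.

Lemma Rintegral_bounds_bdd a b f : bdd_mfun f -> (forall x, a <= f x <= b) ->
  a <= \int[P]_x f x <= b.
Proof.
move=> bf fab; apply/andP; split.
  rewrite -[leLHS]probability_Rintegral_cst.
  apply: le_Rintegral_bdd => //; first exact: bdd_mfun_cst.
  by move=> x; case/andP: (fab x).
rewrite -[leRHS]probability_Rintegral_cst.
apply: le_Rintegral_bdd => //; first exact: bdd_mfun_cst.
by move=> x; case/andP: (fab x).
Qed.

End BoundedMeasurable.

Lemma bdd_mfun_comp {d d'} {T : measurableType d} {U : measurableType d'}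
  {R : realType} (f : U -> R) (g : T -> U) :
  bdd_mfun f -> measurable_fun setT g -> bdd_mfun (fun x => f (g x)).
Proof.
move=> [mf [M fM]] mg; split; last by exists M.
exact: (measurableT_comp mf mg).
Qed.

Lemma le_Rintegral_probability {d} {T : measurableType d} {R : realType}
  (P1 P2 : probability T R) (r : R) (f : T -> R) : 0 <= r ->
  (forall A, measurable A -> (P1 A <= r%:E * P2 A)%E) ->
  bdd_mfun f -> (forall x, 0 <= f x) ->
  \int[P1]_x f x <= r * \int[P2]_x f x.
Proof.
move=> r0 P12 bf f0; rewrite -lee_fin EFinM -!bdd_mfun_EFin//.
pose rn := NngNum r0.
have mf : measurable_fun setT (fun x => (f x)%:E).
  by apply/measurable_EFinP; case: bf.
have e : (r%:E * \int[P2]_x (f x)%:E = \int[mscale rn P2]_x (f x)%:E)%E.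
  by rewrite ge0_integral_mscale// => x _; rewrite lee_fin.
rewrite [leRHS]e; apply: ge0_le_measure_integral => // x.
Qed.

Section Represents.
Context {d} {T : measurableType d} {R : realType}.
Local Open Scope ereal_scope.

(** The measures of the particle system are bare set functions; the work is done on a probability
    with the same values on measurable sets. *)
Definition represents (mu : set T -> \bar R) (P : probability T R) :=
  forall A, measurable A -> mu A = P A.

Import HBNNSimple.

(** Simple functions have measurable level sets, so an integral reads a set function only on
    measurable sets, for arbitrary [f] and [D]. *)
Lemma integral_represents mu P D f :
  represents mu P -> \int[mu]_(x in D) f x = \int[P]_(x in D) f x.
Proof.
move=> muP.
have e (h : {nnsfun T >-> R}) : sintegral mu h = sintegral P h.
  by rewrite /sintegral; apply: eq_fsbigr => r _; rewrite muP.
by rewrite /integral; congr (_ - _); congr (ereal_sup _); apply/seteqP; split;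
  move=> _ [h hf <-]; exists h.
Qed.

(* The integral of a nonnegative function is the lower integral: no
   measurability is needed here. *)
Lemma ge0_le_integral_lower (mu : {measure set T -> \bar R}) f g :
  (forall x, 0 <= f x) -> (forall x, f x <= g x) ->
  \int[mu]_x f x <= \int[mu]_x g x.
Proof.
move=> f0 fg; have g0 x : 0 <= g x := le_trans (f0 x) (fg x).
rewrite !ge0_integralTE//; apply: ereal_sup_le => _ [h hf <-].
by exists h => // x; exact: le_trans (hf x) (fg x).
Qed.

End Represents.

Section ProbabilityOfMeasure.
Context {d} {T : measurableType d} {R : realType}.
Variables (m : {measure set T -> \bar R}) (m1 : m setT = 1%E).

(** The proof of total mass 1 is an argument so that the probability structure can be attached to
    this alias of [m]. *)
Definition unit_mass (_ : m setT = 1%E) : set T -> \bar R := m.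

HB.instance Definition _ := Measure.copy (unit_mass m1) m.

HB.instance Definition _ := Measure_isProbability.Build _ _ _ (unit_mass m1) m1.

Definition probability_of_measure : probability T R := unit_mass m1.

End ProbabilityOfMeasure.

Section Mixture.
Context {d d'} {T : measurableType d} {U : measurableType d'} {R : realType}.
Variables (P : probability T R) (k : R.-fker T ~> U).
Local Open Scope ereal_scope.

Let source (_ : unit) : {measure set T -> \bar R} := P.

Let source_kernel V : measurable V -> measurable_fun setT (source ^~ V).
Proof. by move=> _; exact: measurable_cst. Qed.

HB.instance Definition _ := isKernel.Build _ _ _ _ R source source_kernel.

Let source_uub : measure_fam_uub source.
Proof. by exists 2%R => x; rewrite /source/= probability_setT lte_fin ltr1n. Qed.

HB.instance Definition _ := Kernel_isFinite.Build _ _ _ _ R source source_uub.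

Let target (x : unit * T) : {measure set U -> \bar R} := k x.2.

Let target_kernel V : measurable V -> measurable_fun setT (target ^~ V).
Proof.
move=> mV.
exact: measurableT_comp (measurable_kernel k _ mV) measurable_snd.
Qed.

HB.instance Definition _ := isKernel.Build _ _ _ _ R target target_kernel.

Let target_uub : measure_fam_uub target.
Proof. by have [r kr] := measure_uub k; exists r => x; exact: kr. Qed.

HB.instance Definition _ := Kernel_isFinite.Build _ _ _ _ R target target_uub.

(** The mixture is the composition of two kernels out of the one-point space, the constant kernel
    [P] and [k]; countable additivity and the integral formula are those of kernel composition. *)
Lemma mixture_exists : \int[P]_x k x setT = 1 ->
  exists nu : probability U R,
    (forall A, nu A = \int[P]_x k x A) /\
    forall f, (forall z, 0 <= f z) -> measurable_fun setT f ->
      \int[nu]_z f z = \int[P]_x \int[k x]_z f z.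
Proof.
move=> k1.
pose m : {measure set U -> \bar R} := mkcomp source target tt.
have m1 : m setT = 1 by [].
exists (probability_of_measure m m1); split => // f f0 mf.
exact: (integral_kcomp source target tt f0 mf).
Qed.

End Mixture.

(** * The path-space Feynman-Kac semigroup and its forgetting *)

Section Agree.
Context {E : eqType}.
Implicit Types s t : seq E.

(** Truncated subtraction makes this plain equality once [j] reaches the common length. *)
Definition agree j s t := size s = size t /\ drop (size s - j) s = drop (size t - j) t.

Lemma agree0 s t : size s = size t -> agree 0 s t.
Proof. by move=> st; split => //; rewrite !subn0 !drop_size. Qed.

Lemma agree_sym j s t : agree j s t -> agree j t s.
Proof. by case. Qed.

Lemma agree_rcons j s t x : agree j s t -> agree j.+1 (rcons s x) (rcons t x).
Proof.
move=> [st e]; split; first by rewrite !size_rcons st.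
by rewrite !size_rcons !subSS !drop_rcons ?leq_subr// e.
Qed.

Lemma agree_leq i j s t : (i <= j)%N -> agree j s t -> agree i s t.
Proof.
move=> ij [st e]; split => //.
have h (u : seq E) : size u = size s ->
    drop (size u - i) u = drop (size s - i - (size s - j)) (drop (size u - j) u).
  by move=> us; rewrite us drop_drop subnK// leq_sub2l.
by rewrite (h s)// (h t)// e.
Qed.

Lemma agree_last x0 j s t : (0 < j)%N -> agree j s t -> last x0 s = last x0 t.
Proof.
move=> j0 /(agree_leq _ _ _ _ j0) [st e].
case: (lastP s) st e => [|s' x]; first by case: t.
case: (lastP t) => [|t' y]; first by rewrite size_rcons.
rewrite !size_rcons !subSS !subn0 => -[st]; rewrite !last_rcons.
by rewrite -!cats1 !drop_size_cat//; case.
Qed.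

Lemma agree_full j s t : (size s <= j)%N -> agree j s t -> s = t.
Proof.
move=> sj [st]; have -> : (size s - j = 0)%N by lia.
have -> : (size t - j = 0)%N by lia.
by rewrite !drop0.
Qed.

Lemma agree_nth x0 j s t i : agree j s t -> (size s - j <= i)%N ->
  nth x0 s i = nth x0 t i.
Proof.
move=> [st e] ji; rewrite -(subnKC ji) -nth_drop e st nth_drop.
by congr (nth _ _ _); lia.
Qed.

End Agree.

Section PathFunctions.
Context {d} {E : measurableType d} {R : realType}.
Implicit Types F G : seq E -> R.

(** One function on paths of all lengths, with one bound, lets the semigroup be iterated without
    casts between tuple types. *)
Definition path_mfun F :=
  (forall n, measurable_fun setT (fun t : n.+1.-tuple E => F t)) /\
  exists M, forall s, `|F s| <= M.

Lemma path_mfun_cst r : path_mfun (fun=> r).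
Proof. by split => [n|]; [exact: measurable_cst|exists `|r|]. Qed.

Lemma path_mfunD F G : path_mfun F -> path_mfun G ->
  path_mfun (fun s => F s + G s).
Proof.
move=> [mF [M FM]] [mG [K GK]]; split=> [n|].
  by apply: measurable_funD; [exact: mF|exact: mG].
by exists (M + K) => x; rewrite (le_trans (ler_normD _ _))// lerD.
Qed.

Lemma path_mfunM F G : path_mfun F -> path_mfun G ->
  path_mfun (fun s => F s * G s).
Proof.
move=> [mF [M FM]] [mG [K GK]]; split=> [n|].
  by apply: measurable_funM; [exact: mF|exact: mG].
by exists (M * K) => x; rewrite normrM ler_pM.
Qed.

Lemma path_mfunZ r F : path_mfun F -> path_mfun (fun s => r * F s).
Proof. by move=> ?; apply: path_mfunM => //; exact: path_mfun_cst. Qed.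

Lemma path_mfun_tuple F n : path_mfun F ->
  bdd_mfun (fun t : n.+1.-tuple E => F t).
Proof. by move=> [mF [M FM]]; split; [exact: mF|exists M]. Qed.

Lemma measurable_rcons_tuple n :
  measurable_fun setT (fun tx : n.-tuple E * E => [tuple of rcons tx.1 tx.2]).
Proof.
apply/measurable_fun_tnthP => i.
have [i_n|n_i] := ltnP i n.
  have -> : (@tnth _ E ^~ i) \o (fun tx : n.-tuple E * E =>
      [tuple of rcons tx.1 tx.2]) = (fun tx => tnth tx.1 (Ordinal i_n)).
    apply/funext => -[t x] /=.
    by rewrite !(tnth_nth x) /= nth_rcons size_tuple i_n.
  exact: measurableT_comp (measurable_tnth _) measurable_fst.
have -> : (@tnth _ E ^~ i) \o (fun tx : n.-tuple E * E =>
    [tuple of rcons tx.1 tx.2]) = snd.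
  apply/funext => -[t x] /=.
  rewrite !(tnth_nth x) /= nth_rcons size_tuple.
  have -> : nat_of_ord i = n by have := ltn_ord i; lia.
  by rewrite ltnn eqxx.
exact: measurable_snd.
Qed.

Lemma path_mfun_rcons F s : path_mfun F -> bdd_mfun (fun x => F (rcons s x)).
Proof.
move=> [mF [M FM]]; split; last by exists M.
have -> : (fun x => F (rcons s x)) =
    (fun t : (size s).+1.-tuple E => F t) \o
    (fun tx : (size s).-tuple E * E => [tuple of rcons tx.1 tx.2]) \o
    (fun x => (in_tuple s, x)) by apply/funext.
apply: measurableT_comp; last exact: measurable_fun_pair.
exact: measurableT_comp (mF _) (measurable_rcons_tuple _).
Qed.

End PathFunctions.

Section FeynmanKacSemigroup.
Context {d} {E : measurableType d} {R : realType}.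
Variables (x0 : E) (Q : nat -> R.-pker E ~> E) (Psi : seq E -> R).
Implicit Types F G : seq E -> R.

Definition last_kernel n (t : n.+1.-tuple E) : {measure set E -> \bar R} :=
  Q n.+1 (last x0 t).

Lemma measurable_last_tuple n :
  measurable_fun setT (fun t : n.+1.-tuple E => last x0 t).
Proof.
have -> : (fun t : n.+1.-tuple E => last x0 t) = (@tnth _ E ^~ ord_max).
  by apply/funext => t; rewrite (tnth_nth x0)/= (last_nth x0) size_tuple;
     case: t => -[].
exact: measurable_tnth.
Qed.

Let last_kernel_measurable n U : measurable U ->
  measurable_fun setT ((last_kernel n) ^~ U).
Proof.
move=> mU.
exact: measurableT_comp (measurable_kernel (Q n.+1) _ mU) (measurable_last_tuple n).
Qed.

HB.instance Definition _ n := isKernel.Build _ _ _ _ R (last_kernel n)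
  (last_kernel_measurable n).

Let last_kernel_uub n : measure_fam_uub (last_kernel n).
Proof.
by exists 2%R => t; rewrite /last_kernel prob_kernel lte_fin ltr1n.
Qed.

HB.instance Definition _ n := Kernel_isFinite.Build _ _ _ _ R (last_kernel n)
  (last_kernel_uub n).

Hypothesis Psi_path : path_mfun Psi.


Definition transition n l : probability E R :=
  probability_of_measure (Q n l) (prob_kernel l).

(** The backward operator dual to [gammaop]. A path with indices 0, ..., n has n + 1 entries, so the
    length of [s] is the time of the next transition. *)
Definition fk_step F s : R :=
  \int[transition (size s) (last x0 s)]_x (Psi (rcons s x) * F (rcons s x)).

Let integrand_bdd F s : path_mfun F ->
  bdd_mfun (fun x => Psi (rcons s x) * F (rcons s x)).
Proof. by move=> mF; exact: (path_mfun_rcons _ s (path_mfunM _ _ Psi_path mF)). Qed.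

Lemma path_mfun_step F : path_mfun F -> path_mfun (fk_step F).
Proof.
move=> mF; have [mG [M GM]] := path_mfunM _ _ Psi_path mF.
split=> [n|]; last first.
  exists M => s; have /Rintegral_bounds_bdd := integrand_bdd F s mF.
  move=> /(_ (transition (size s) (last x0 s)) (- M) M) h.
  by rewrite ler_norml; apply: h => x; rewrite -ler_norml.
(* Kernel integrals are measurable for nonnegative integrands: the bound [M] is added here and
   subtracted after integration. *)
pose G (tx : n.+1.-tuple E * E) :=
  (Psi (rcons tx.1 tx.2) * F (rcons tx.1 tx.2) + M)%:E.
have mG' : measurable_fun setT G.
  apply/measurable_EFinP/measurable_funD => //.
  exact: measurableT_comp (mG n.+1) (measurable_rcons_tuple n.+1).
have G0 tx : (0 <= G tx)%E.
  rewrite lee_fin; have := GM (rcons tx.1 tx.2); rewrite ler_norml => /andP[+ _].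
  by rewrite -lerBlDr sub0r.
have mI := measurable_fun_integral_finite_kernel G (@last_kernel n) G0 mG'.
have -> : (fun t : n.+1.-tuple E => fk_step F t) = (fun t =>
    fine (\int[last_kernel n t]_x G (t, x))%E - M).
  apply/funext => t.
  rewrite /fk_step size_tuple.
  set P := transition _ _.
  have bI := integrand_bdd F t mF.
  rewrite -[X in X = _](addrK M) -{1}[M](probability_Rintegral_cst P).
  by rewrite -RintegralD_bdd//; exact: bdd_mfun_cst.
by apply: measurable_funB => //; exact: measurableT_comp.
Qed.

Lemma path_mfun_iter n F : path_mfun F -> path_mfun (iter n fk_step F).
Proof. by move=> mF; elim: n => //= n; exact: path_mfun_step. Qed.

Lemma fk_stepD c F G : path_mfun F -> path_mfun G ->
  fk_step (fun s => F s + c * G s) = (fun s => fk_step F s + c * fk_step G s).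
Proof.
move=> mF mG; apply/funext => s; rewrite /fk_step.
rewrite -RintegralZ_bdd; last exact: integrand_bdd.
rewrite -RintegralD_bdd; [|exact: integrand_bdd|exact/bdd_mfunZ/integrand_bdd].
by apply: eq_Rintegral => x _; ring.
Qed.

Lemma fk_iterD n c F G : path_mfun F -> path_mfun G ->
  iter n fk_step (fun s => F s + c * G s) =
  (fun s => iter n fk_step F s + c * iter n fk_step G s).
Proof.
move=> mF mG; elim: n => //= n ->.
by rewrite fk_stepD//; exact: path_mfun_iter.
Qed.

Variables lo hi : R.
Hypothesis lo_gt0 : 0 < lo.
Hypothesis Psi_bounds : forall s, lo <= Psi s <= hi.

Let Psi_ge0 s : 0 <= Psi s.
Proof. by have /andP[+ _] := Psi_bounds s; apply: le_trans; exact: ltW. Qed.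

Lemma fk_iter_ge0 n F s : path_mfun F ->
  (forall t, size t = (size s + n)%N -> 0 <= F t) -> 0 <= iter n fk_step F s.
Proof.
move=> mF; elim: n s => [|n IH] s F0; first by apply: F0; rewrite addn0.
apply: Rintegral_ge0 => x _; apply: mulr_ge0 => //; apply: IH => t st.
by apply: F0; rewrite st size_rcons addnS.
Qed.

Lemma fk_iter_le n F G s : path_mfun F -> path_mfun G ->
  (forall t, size t = (size s + n)%N -> F t <= G t) ->
  iter n fk_step F s <= iter n fk_step G s.
Proof.
move=> mF mG FG; rewrite -subr_ge0.
have := @fk_iter_ge0 n (fun s => G s + (-1) * F s) s.
rewrite fk_iterD// mulN1r; apply.
  by apply: path_mfunD => //; exact: path_mfunZ.
by move=> t st; rewrite mulN1r subr_ge0 FG.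
Qed.

Lemma fk_iter1_ge n s : lo ^+ n <= iter n fk_step (fun=> 1) s.
Proof.
elim: n s => [|n IH] s //.
have b : bdd_mfun (fun x : E => Psi (rcons s x) * iter n fk_step (fun=> 1) (rcons s x)).
  exact/integrand_bdd/path_mfun_iter/path_mfun_cst.
rewrite -[leLHS](probability_Rintegral_cst (transition (size s) (last x0 s))).
apply: le_Rintegral_bdd => //; first exact: bdd_mfun_cst.
move=> x; rewrite exprS; apply: ler_pM.
- exact: ltW.
- by rewrite exprn_ge0// ltW.
- by case/andP: (Psi_bounds (rcons s x)).
- exact: IH.
Qed.

Lemma fk_iter1_gt0 n s : 0 < iter n fk_step (fun=> 1) s.
Proof. by apply: lt_le_trans (fk_iter1_ge n s); rewrite exprn_gt0. Qed.

Variables K tau kap : R.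
Hypothesis K_ge0 : 0 <= K.
Hypothesis tau_gt0 : 0 < tau.
Hypothesis tau_lt1 : tau < 1.
Hypothesis kap_ge1 : 1 <= kap.
Hypothesis Psi_agree : forall j s t, (0 < j)%N -> agree j s t ->
  Psi s <= expR (K * tau ^+ j) * Psi t.
Hypothesis Q_compare : forall n l l' A, (0 < n)%N -> measurable A ->
  (Q n l A <= kap%:E * Q n l' A)%E.

(** The sum of the geometric series [K * tau ^+ i] over i >= 1. *)
Definition memory_rate := K * tau / (1 - tau).

Lemma memory_rate_ge0 : 0 <= memory_rate.
Proof. by rewrite divr_ge0 ?mulr_ge0 ?subr_ge0 ?(ltW tau_gt0) ?(ltW tau_lt1). Qed.

(* Solves [K tau^(j+1) + memory_rate tau^(j+1) = memory_rate tau^j]: the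
   log-likelihood ratios of the successive potentials add up. *)
Lemma memory_rateS j :
  expR (K * tau ^+ j.+1) * expR (memory_rate * tau ^+ j.+1) =
  expR (memory_rate * tau ^+ j).
Proof.
rewrite -expRD /memory_rate exprS; congr expR.
by field; rewrite subr_eq0 gt_eqF.
Qed.

(** Two paths with a common last coordinate make the same next transition; only when no coordinate
    is shared must two kernels be compared, at the price [kap]. *)
Definition start_cost j := if j == 0%N then kap else 1.

Lemma start_cost_ge1 j : 1 <= start_cost j.
Proof. by rewrite /start_cost; case: ifP. Qed.

(** Both pasts are continued by the same new coordinates, so the number of shared ones grows at each
    step and the ratios of potentials multiply to at most [expR (memory_rate * tau ^+ j)]. Different
    kernels can occur only at the first transition, hence [kap] is paid at most once, whatever
    [n]. *)
Lemma fk_compare n j s s' F F' : path_mfun F -> path_mfun F' ->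
  (0 < size s)%N -> agree j s s' ->
  (forall t, size t = (size s + n)%N -> 0 <= F t) ->
  (forall t, size t = (size s + n)%N -> 0 <= F' t) ->
  (forall t t', size t = (size s + n)%N -> agree (j + n) t t' -> F t <= F' t') ->
  iter n fk_step F s <=
    start_cost j * expR (memory_rate * tau ^+ j) * iter n fk_step F' s'.
Proof.
move=> mF mF'; elim: n j s s' => [|n IH] j s s' s_gt0 ss' F0 F'0 FF'.
  have FF := FF' s s' (esym (addn0 _)) ltac:(by rewrite addn0).
  have {}F0 := F0 s (esym (addn0 _)).
  rewrite /= (le_trans FF)// ler_peMl//; first exact: le_trans FF.
  rewrite -[leLHS]mulr1 ler_pM// ?start_cost_ge1//.
  rewrite -{1}expR0 ler_expR mulr_ge0 ?memory_rate_ge0// exprn_ge0//.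
  exact: ltW.
have ss : size s = size s' by case: ss'.
have sz x : (size (rcons s x) + n = size s + n.+1)%N.
  by rewrite size_rcons addSnnS.
pose H t := Psi t * iter n fk_step F t.
pose H' t := Psi t * iter n fk_step F' t.
pose c := expR (memory_rate * tau ^+ j).
have bH u : bdd_mfun (fun x => H (rcons u x)).
  exact/integrand_bdd/path_mfun_iter.
have bH' u : bdd_mfun (fun x => H' (rcons u x)).
  exact/integrand_bdd/path_mfun_iter.
have iF0 x : 0 <= iter n fk_step F (rcons s x).
  by apply: fk_iter_ge0 => // t; rewrite sz; exact: F0.
have iF'0 x : 0 <= iter n fk_step F' (rcons s' x).
  by apply: fk_iter_ge0 => // t; rewrite size_rcons addSnnS -ss; exact: F'0.
(* After the common coordinate [x] the paths share [j.+1] coordinates: the induction hypothesis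
   applies with start cost 1. *)
have HH' x : H (rcons s x) <= c * H' (rcons s' x).
  have a1 := agree_rcons _ _ _ x ss'.
  rewrite /c -memory_rateS /H /H' mulrACA ler_pM//; first exact: Psi_agree.
  have := IH j.+1 (rcons s x) (rcons s' x) _ a1.
  rewrite size_rcons addSnnS /start_cost/= mul1r; apply => //.
  by move=> t t' st; rewrite addSnnS; exact: FF'.
have cH0 x : 0 <= c * H' (rcons s' x).
  by rewrite mulr_ge0 ?expR_ge0// mulr_ge0.
apply: (@le_trans _ _ (\int[transition (size s) (last x0 s)]_x (c * H' (rcons s' x)))).
  by apply: le_Rintegral_bdd; [exact: bH|exact/bdd_mfunZ/bH'|exact: HH'].
rewrite -mulrA -/c.
have -> : c * iter n.+1 fk_step F' s' =
   \int[transition (size s) (last x0 s')]_x (c * H' (rcons s' x)).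
  by rewrite RintegralZ_bdd ?ss.
(* Only the starting points of the two transitions remain to be matched. *)
rewrite /start_cost; case: eqP => [j0|j0].
  apply: le_Rintegral_probability => //.
  - exact: le_trans kap_ge1.
  - by move=> A mA; exact: Q_compare.
  - exact/bdd_mfunZ/bH'.
by rewrite mul1r (agree_last x0 _ _ _ _ ss')// lt0n; exact/eqP.
Qed.

Lemma fk_iterZ n c F : path_mfun F ->
  iter n fk_step (fun s => c * F s) = (fun s => c * iter n fk_step F s).
Proof.
move=> mF; elim: n => //= n ->; apply/funext => s.
rewrite -RintegralZ_bdd; last exact/integrand_bdd/path_mfun_iter.
by apply: eq_Rintegral => x _; ring.
Qed.

(** The mean of [F] under the normalised law of the path [s] continued by [n] weighted steps. *)
Definition fk_ratio n F s := iter n fk_step F s / iter n fk_step (fun=> 1) s.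

Lemma fk_iter_ratio n F s :
  iter n fk_step F s = fk_ratio n F s * iter n fk_step (fun=> 1) s.
Proof. by rewrite /fk_ratio divfK// gt_eqF// fk_iter1_gt0. Qed.

Lemma fk_ratio_bounds n a b F s : path_mfun F ->
  (forall t, size t = (size s + n)%N -> a <= F t <= b) ->
  a <= fk_ratio n F s <= b.
Proof.
move=> mF Fab; have m1 := path_mfun_cst (E := E) (1 : R).
rewrite /fk_ratio ler_pdivlMr ?fk_iter1_gt0// ler_pdivrMr ?fk_iter1_gt0//.
have e c : c * iter n fk_step (fun=> 1) s = iter n fk_step (fun=> c * 1) s.
  by rewrite fk_iterZ.
rewrite !e; apply/andP; split; apply: fk_iter_le => //; do ?exact: path_mfunZ.
- by move=> t st; rewrite mulr1; case/andP: (Fab t st).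
- by move=> t st; rewrite mulr1; case/andP: (Fab t st).
Qed.

(** * Oscillation of the normalised semigroup on functions of recent coordinates *)

Section Forgetting.
Variables (p : nat) (F : seq E -> R).
Hypothesis F_path : path_mfun F.
Hypothesis F01 : forall t, 0 <= F t <= 1.
Hypothesis F_recent : forall t t', agree p t t' -> F t = F t'.

Let F_ge0 t : 0 <= F t. Proof. by case/andP: (F01 t). Qed.
Let m1 : path_mfun (fun=> 1 : R) := path_mfun_cst (E := E) (1 : R).

(** With [x] for the memory term, numerator and denominator each change by a factor at most exp(x),
    so the ratio changes by at most exp(2x). For values in [0, 1] this is a difference of at most 1
    - exp(-2x) <= 2x. *)
Lemma fk_ratio_recent n m s s' : (p <= n)%N -> (0 < m)%N -> (0 < size s)%N ->
  agree m s s' ->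
  fk_ratio n F s' - fk_ratio n F s <= 2 * memory_rate * tau ^+ m.
Proof.
move=> pn m_gt0 s_gt0 ss'; set x := memory_rate * tau ^+ m.
have cost1 : start_cost m = 1 by rewrite /start_cost gtn_eqF.
have ss : size s = size s' by case: ss'.
have /= := @fk_compare n m s' s F F F_path F_path _ (agree_sym _ _ _ ss').
rewrite cost1 mul1r -/x -ss => /(_ s_gt0 (fun t _ => F_ge0 t) (fun t _ => F_ge0 t)).
move=> /(_ _)/wrap[t t' _ tt'|AA].
  by rewrite (F_recent t t')//; apply: agree_leq tt'; lia.
have /= := @fk_compare n m s s' _ _ m1 m1 s_gt0 ss'
  (fun _ _ => ler01) (fun _ _ => ler01) (fun _ _ _ _ => lexx _).
rewrite cost1 mul1r -/x => BB.
have G0 := fk_iter1_gt0 n s; have G'0 := fk_iter1_gt0 n s'.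
have /andP[r'0 r'1] : 0 <= fk_ratio n F s' <= 1 by apply: fk_ratio_bounds.
have /andP[r0 r1] : 0 <= fk_ratio n F s <= 1 by apply: fk_ratio_bounds.
move: AA; rewrite (fk_iter_ratio n F s) (fk_iter_ratio n F s') => AA.
have h : fk_ratio n F s' <= expR (2 * x) * fk_ratio n F s.
  rewrite -(ler_pM2r G'0) (le_trans AA)//.
  have -> : expR (2 * x) * fk_ratio n F s * iter n fk_step (fun=> 1) s' =
      expR x * (fk_ratio n F s * (expR x * iter n fk_step (fun=> 1) s')).
    have -> : expR (2 * x) = expR x * expR x by rewrite -expRD; congr expR; ring.
    ring.
  by rewrite ler_pM2l ?expR_gt0// ler_wpM2l.
have h2 : fk_ratio n F s' * expR (- (2 * x)) <= fk_ratio n F s.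
  by rewrite expRN ler_pdivrMr ?expR_gt0// mulrC.
have h3 := expR_ge1Dx (- (2 * x)).
have h4 : fk_ratio n F s' * (1 - expR (- (2 * x))) <= 1 - expR (- (2 * x)).
  rewrite ler_piMl// subr_ge0 -expR0 ler_expR oppr_le0 mulr_ge0//.
  by rewrite mulr_ge0 ?memory_rate_ge0// exprn_ge0// ltW.
rewrite -mulrA -/x; lra.
Qed.

(** One factor [kap * expR memory_rate] compares the numerators of two ratios and one their
    denominators; the last [expR memory_rate] bounds the change of the remaining mass between paths
    that share m coordinates. *)
Definition forget_const := (kap * expR memory_rate) ^+ 2 * expR memory_rate.

Variable b : nat -> R.
Hypothesis b0_ge1 : 1 <= b 0%N.
Hypothesis b_rec : forall L, (0 < L)%N -> 1 <= b L \/ exists m, (0 < m <= L)%N /\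
  (1 - forget_const^-1) * b (L - m)%N + 2 * memory_rate * tau ^+ m <= b L.

(* The first m steps forget all but a fraction [1 - 1 / forget_const] of the
   oscillation; what the remaining steps still remember beyond the last m
   coordinates is at most [2 * memory_rate * tau ^+ m]. *)
Lemma fk_ratio_osc L n s s' : (p + L <= n)%N -> (0 < size s)%N ->
  size s = size s' -> fk_ratio n F s' - fk_ratio n F s <= b L.
Proof.
elim/ltn_ind: L n s s' => L IH n s s' pLn s_gt0 ss.
have trivial : 1 <= b L -> fk_ratio n F s' - fk_ratio n F s <= b L.
  move=> bL; have /andP[_ r'1] : 0 <= fk_ratio n F s' <= 1 by apply: fk_ratio_bounds.
  have /andP[r0 _] : 0 <= fk_ratio n F s <= 1 by apply: fk_ratio_bounds.
  by rewrite (le_trans _ bL)// lerBlDr (le_trans r'1)// lerDl.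
have [L0|L_gt0] := posnP L; first by apply: trivial; rewrite L0.
have [//|[m [/andP[m_gt0 mL] bm]]] := b_rec L L_gt0.
pose n2 := (n - m)%N; have nE : n = (m + n2)%N by rewrite /n2; lia.
pose g := iter n2 fk_step (fun=> 1).
have mg : path_mfun g by exact: path_mfun_iter.
have IH' t t' : size t = (size s + m)%N -> size t' = (size s + m)%N ->
    fk_ratio n2 F t' - fk_ratio n2 F t <= b (L - m)%N.
  by move=> st st'; apply: IH; rewrite ?st ?st'// /n2; lia.
(* [al] is the infimum of the ratios still to be computed after [m] steps; by induction they all lie
   within [b (L - m)] above it. *)
have [al al_bounds] : exists al, forall t, size t = (size s + m)%N ->
    al <= fk_ratio n2 F t <= al + b (L - m)%N.
  pose V := [set fk_ratio n2 F t | t in [set t | size t = (size s + m)%N]].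
  have Vlb : has_lbound V.
    exists 0 => _ [t _ <-].
    by have /andP[] : 0 <= fk_ratio n2 F t <= 1 by apply: fk_ratio_bounds.
  have V0 : V !=set0.
    exists (fk_ratio n2 F (nseq (size s + m) x0)); exists (nseq (size s + m) x0) => //=.
    by rewrite size_nseq.
  exists (inf V) => t st; apply/andP; split; first by apply: ge_inf => //; exists t.
  rewrite -lerBlDr; apply: lb_le_inf => // _ [t' st' <-].
  by rewrite lerBlDr -lerBlDl; exact: IH'.
pose e := expR (memory_rate * tau ^+ m).
pose eta := 2 * memory_rate * tau ^+ m.
(* [F - al] may be negative, but its image under the last [n2] steps is not; the comparison is
   applied to this intermediate function, on paths of length [size s + m]. *)
pose H := iter n2 fk_step (fun t => F t + (- al) * 1).
have mFal : path_mfun (fun t => F t + (- al) * 1).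
  by apply: path_mfunD => //; exact: path_mfun_cst.
have mH : path_mfun H by exact: path_mfun_iter.
have HE t : H t = (fk_ratio n2 F t - al) * g t.
  by rewrite /H fk_iterD// fk_iter_ratio -/g; ring.
have g0 t : 0 < g t by exact: fk_iter1_gt0.
have H0 t : size t = (size s + m)%N -> 0 <= H t.
  move=> st; rewrite HE mulr_ge0 ?(ltW (g0 _))// subr_ge0.
  by case/andP: (al_bounds t st).
have eta0 : 0 <= eta.
  apply: mulr_ge0; first by rewrite mulr_ge0 ?memory_rate_ge0.
  by rewrite exprn_ge0// ltW.
have mHg : path_mfun (fun t => H t + eta * g t).
  by apply: path_mfunD => //; exact: path_mfunZ.
have Hg0 t : size t = (size s + m)%N -> 0 <= H t + eta * g t.
  by move=> st; rewrite addr_ge0 ?H0// mulr_ge0// ltW.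
(* On paths sharing their last [m] coordinates, [g] varies by the factor [e] and the ratio by [eta],
   which is why [eta * g] is added on the right. *)
have cmp : iter m fk_step H s' <= kap * expR memory_rate *
    (e * (iter m fk_step H s + eta * iter m fk_step g s)).
  have := @fk_compare m 0%N s' s H (fun t => e * (H t + eta * g t)) mH
    (path_mfunZ _ _ mHg).
  rewrite -ss expr0 mulr1 fk_iterZ// fk_iterD//; apply => //.
  - exact: agree0.
  - by move=> t st; rewrite mulr_ge0 ?expR_ge0// Hg0.
  - move=> t t' st tt'.
    have st' : size t' = (size s + m)%N by case: tt' => <-.
    have := @fk_compare n2 m t t' _ _ m1 m1 _ tt'
      (fun _ _ => ler01) (fun _ _ => ler01) (fun _ _ _ _ => lexx _).
    rewrite /start_cost gtn_eqF// mul1r -/e -/g st addn_gt0 s_gt0 => /(_ isT) gg.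
    have rec : fk_ratio n2 F t - fk_ratio n2 F t' <= eta.
      apply: fk_ratio_recent => //; first by rewrite /n2; lia.
        by rewrite st' addn_gt0 s_gt0.
      exact: agree_sym.
    rewrite !HE -mulrDl mulrCA.
    have /andP[al1 _] := al_bounds t st.
    apply: ler_pM; rewrite ?subr_ge0 ?(ltW (g0 _))//.
    by rewrite addrAC lerD2r -lerBlDl.
have iter1 t : iter m fk_step g t = iter n fk_step (fun=> 1) t.
  by rewrite nE iterD.
have iterH t : iter m fk_step H t =
    (fk_ratio n F t - al) * iter n fk_step (fun=> 1) t.
  rewrite /H -iterD -nE fk_iterD// fk_iter_ratio; ring.
have G0 := fk_iter1_gt0 n s; have G'0 := fk_iter1_gt0 n s'.
move: cmp; rewrite !iterH !iter1 -mulrDl.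
set G := iter n fk_step _ s in G0 *; set G' := iter n fk_step _ s' in G'0 *.
set r := fk_ratio n F s; set r' := fk_ratio n F s'.
have ral : 0 <= r - al.
  have : 0 <= iter m fk_step H s by exact: fk_iter_ge0.
  by rewrite iterH -/G pmulr_lge0.
have r'al : r' - al <= b (L - m)%N.
  have : iter m fk_step H s' <= iter m fk_step (fun t => b (L - m)%N * g t) s'.
    apply: fk_iter_le => //; first exact: path_mfunZ.
    move=> t; rewrite -ss => st; rewrite HE ler_pM2r// lerBlDl.
    by case/andP: (al_bounds t st).
  by rewrite fk_iterZ// iterH iter1 -/G' ler_pM2r.
have GG' : G <= kap * expR memory_rate * G'.
  have := @fk_compare n 0%N s s' _ _ m1 m1 s_gt0 (agree0 _ _ ss)
      (fun _ _ => ler01) (fun _ _ => ler01) (fun _ _ _ _ => lexx _).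
  by rewrite expr0 mulr1.
have e_le : e <= expR memory_rate.
  rewrite ler_expR ler_piMr ?memory_rate_ge0// exprn_ile1 ?ltW//.
have kap0 : 0 < kap := lt_le_trans ltr01 kap_ge1.
have B0 : 0 < kap * expR memory_rate by rewrite mulr_gt0 ?expR_gt0.
move=> cmp.
have fc0 : 0 < forget_const by rewrite mulr_gt0 ?expR_gt0// exprn_gt0.
(* A minorisation: the excess over [al] seen from [s] is at least a fixed fraction of that seen from
   [s'], up to [eta]. *)
have key : r' - al <= forget_const * (r - al + eta).
  rewrite -(ler_pM2r G'0) (le_trans cmp)//.
  have -> : kap * expR memory_rate * (e * ((r - al + eta) * G)) =
      (kap * expR memory_rate * (r - al + eta)) * (e * G) by ring.
  have -> : forget_const * (r - al + eta) * G' =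
     (kap * expR memory_rate * (r - al + eta)) *
      (expR memory_rate * (kap * expR memory_rate * G')).
    by rewrite /forget_const; ring.
  rewrite ler_wpM2l//; first by rewrite mulr_ge0 ?(ltW B0)// addr_ge0.
  by rewrite ler_pM ?expR_ge0// ltW.
have key2 : (r' - al) * forget_const^-1 <= r - al + eta.
  by rewrite ler_pdivrMr// mulrC.
have : (1 - forget_const^-1) * (r' - al) <= (1 - forget_const^-1) * b (L - m)%N.
  rewrite ler_wpM2l// subr_ge0 invf_le1// /forget_const.
  have : 1 <= expR memory_rate by rewrite -expR0 ler_expR memory_rate_ge0.
  move=> e1; rewrite -[leLHS]mulr1 ler_pM// exprn_ege1//.
  by rewrite -[leLHS]mulr1 ler_pM.
move=> h; apply: le_trans bm; rewrite -/eta.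
(* The first term contracts the previous oscillation; [key2] bounds the second by [eta]. *)
have -> : r' - r = (1 - forget_const^-1) * (r' - al) +
    ((r' - al) * forget_const^-1 - (r - al)) by ring.
by apply: lerD => //; rewrite lerBlDl.
Qed.

End Forgetting.

End FeynmanKacSemigroup.

(** * Sampling error of one particle step *)

Lemma represents_pushforward {d d'} {T : measurableType d} {U : measurableType d'}
    {R : realType} (mu : set T -> \bar R) (P : probability T R) (f : T -> U) :
  represents mu P -> measurable_fun setT f ->
  exists P' : probability U R, represents (pushforward mu f) P' /\
    forall g : U -> R, bdd_mfun g -> \int[P']_y g y = \int[P]_x g (f x).
Proof.
move=> muP mf.
pose X : {RV P >-> U} := HB.pack f (isMeasurableFun.Build _ _ _ _ f mf).
exists (distribution P X); split=> [A mA|g bg].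
  by rewrite /pushforward muP// -[_ @^-1` _]setTI; exact: (mf measurableT).
congr fine; rewrite integral_pushforward//=.
  by apply/measurable_EFinP; case: bg.
exact: (bdd_mfun_integrable _ _ (bdd_mfun_comp g f bg mf)).
Qed.

Lemma Rintegral_product {d d'} {T : measurableType d} {U : measurableType d'}
    {R : realType} (P : probability T R) (P' : probability U R)
    (f : T * U -> R) : bdd_mfun f ->
  \int[(P \x P')%E]_z f z = \int[P]_x \int[P']_y f (x, y).
Proof.
move=> bf; pose PP : probability (T * U)%type R := (P \x P')%E.
have intf := bdd_mfun_integrable PP f bf.
congr fine; rewrite -[LHS](integral12_prod_meas1 intf).
apply: eq_integral => x _; rewrite /fubini_F bdd_mfun_EFin//.
by apply: bdd_mfun_comp => //; exact: measurable_fun_pair.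
Qed.

Section MonteCarlo.
Context {d} {T : measurableType d} {R : realType}.
Variables (mu : set T -> \bar R) (P : probability T R).
Hypothesis muP : represents mu P.

Definition tuple_sum (phi : T -> R) {N} (z : N.-tuple T) : R :=
  \sum_(i < N) phi (tnth z i).

Lemma bdd_mfun_tuple_sum phi N : bdd_mfun phi ->
  bdd_mfun (fun z : N.-tuple T => tuple_sum phi z).
Proof.
move=> bphi; apply: bdd_mfun_sum => i.
exact: (bdd_mfun_comp phi (fun z : N.-tuple T => tnth z i) bphi (measurable_tnth i)).
Qed.

Lemma measurable_cons_tuple N :
  measurable_fun setT (fun xt : T * N.-tuple T => cons_tuple xt.1 xt.2).
Proof.
have := @measurable_cons _ _ (T * N.-tuple T)%type T fst N snd
  measurable_fst measurable_snd.
by congr measurable_fun; apply/funext => -[x t]; exact/val_inj.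
Qed.

(** The law of N + 1 draws is the image of [P \x PN] under cons. The cross term of the square
    vanishes because the sum of the other draws is centred, so variances add. A single [PN] serves
    all [phi]. *)
Lemma iid_law_represents N : exists PN : probability (N.-tuple T) R,
  represents (iid_law N mu) PN /\
  forall phi : T -> R, bdd_mfun phi -> \int[P]_x phi x = 0 ->
    \int[PN]_z tuple_sum phi z = 0 /\
    \int[PN]_z (tuple_sum phi z) ^+ 2 = N%:R * \int[P]_x (phi x) ^+ 2.
Proof.
elim: N => [|N [PN [rPN IH]]].
  exists (\d_([tuple])); split=> [//|phi _ _].
  have e (z : 0.-tuple T) : tuple_sum phi z = 0 by rewrite /tuple_sum big_ord0.
  split.
    by under eq_Rintegral do rewrite e; rewrite probability_Rintegral_cst.
  under eq_Rintegral do rewrite e expr0n/=.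
  by rewrite probability_Rintegral_cst mul0r.
have mc := measurable_cons_tuple N.
have rprod : represents (P \x PN)%E (P \x PN)%E by [].
have [P' [rP' intP']] := represents_pushforward _ _ _ rprod mc.
exists P'; split=> [A mA|phi bphi phi0].
  rewrite -rP'// /pushforward /product_measure1 /=.
  rewrite (integral_represents _ _ _ _ muP); apply: eq_integral => x _ /=.
  have mxA : measurable (xsection ((fun xt : T * N.-tuple T =>
      cons_tuple xt.1 xt.2) @^-1` A) x).
    by apply: measurable_xsection; rewrite -[_ @^-1` _]setTI; exact: mc.
  rewrite -rPN//; congr (iid_law _ _ _).
  by apply/seteqP; split=> t /=; rewrite /xsection /= in_setE.
have sumE x (t : N.-tuple T) :
    tuple_sum phi (cons_tuple x t) = phi x + tuple_sum phi t.
  rewrite /tuple_sum big_ord_recl; congr (_ + _).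
  by apply: eq_bigr => i _; rewrite tnthS.
have [S0 S2] := IH phi bphi phi0.
have bS := bdd_mfun_tuple_sum phi N bphi.
have bS' := bdd_mfun_tuple_sum phi N.+1 bphi.
have bX2 U (dU : measurableType U) (f : dU -> R) :
    bdd_mfun f -> bdd_mfun (fun x => f x ^+ 2).
  by move=> bf; under eq_fun do rewrite expr2; exact: bdd_mfunM.
split.
  rewrite intP'// Rintegral_product; last exact: bdd_mfun_comp mc.
  have e x : \int[PN]_y tuple_sum phi (cons_tuple x y) = phi x.
    under eq_Rintegral do rewrite sumE.
    rewrite RintegralD_bdd//; first by rewrite probability_Rintegral_cst S0 addr0.
    exact: bdd_mfun_cst.
  under eq_Rintegral do rewrite e.
  exact: phi0.
rewrite intP'; last exact: bX2.
rewrite Rintegral_product; last exact: (bdd_mfun_comp _ _ (bX2 _ _ _ bS') mc).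
have e x : \int[PN]_y tuple_sum phi (cons_tuple x y) ^+ 2 =
    phi x ^+ 2 + N%:R * \int[P]_x (phi x) ^+ 2.
  under eq_Rintegral do rewrite sumE sqrrD -mulr_natl mulrA.
  rewrite RintegralD_bdd; last exact: bX2.
    rewrite RintegralD_bdd; last exact: bdd_mfunZ.
      by rewrite probability_Rintegral_cst RintegralZ_bdd// S0 mulr0 addr0 S2.
    exact: bdd_mfun_cst.
  by apply: bdd_mfunD; [exact: bdd_mfun_cst|exact: bdd_mfunZ].
under eq_Rintegral do rewrite e.
rewrite RintegralD_bdd; last exact: bdd_mfun_cst.
  by rewrite probability_Rintegral_cst -natr1; ring.
exact: bX2.
Qed.

(** The variance of |X| is nonnegative. *)
Lemma mean_abs_le_sqrt (X : T -> R) (v : R) : bdd_mfun X ->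
  \int[P]_x (X x) ^+ 2 <= v ^+ 2 -> 0 <= v -> \int[P]_x `|X x| <= v.
Proof.
move=> bX Xv v0; set m := \int[P]_x _.
have bX2 : bdd_mfun (fun x => X x ^+ 2).
  by under eq_fun do rewrite expr2; exact: bdd_mfunM.
have bA := bdd_mfun_norm _ bX.
have : 0 <= \int[P]_x (`|X x| - m) ^+ 2.
  by apply: Rintegral_ge0 => x _; exact: sqr_ge0.
have e x : (`|X x| - m) ^+ 2 = (X x ^+ 2 + (- (2 * m)) * `|X x|) + m ^+ 2.
  by rewrite sqrrB real_normK ?num_real//; ring.
under eq_Rintegral do rewrite e.
rewrite RintegralD_bdd; [|by apply: bdd_mfunD => //; exact: bdd_mfunZ
  |exact: bdd_mfun_cst].
rewrite RintegralD_bdd//; last exact: bdd_mfunZ.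
rewrite RintegralZ_bdd// probability_Rintegral_cst -/m => h.
rewrite -(@ler_pXn2r _ 2)// ?nnegrE//; first by move: h Xv; clear; lra.
by apply: Rintegral_ge0.
Qed.

End MonteCarlo.

(** With [th] the exact ratio and [a] the mean of [g0], the error is the sum of the centred function
    [g - th * g0] over the sum of [g0]. The former function is at most [om * B * a] in absolute
    value, the latter sum at least [N * a / B]: [a] cancels, and the bound is proportional to the
    oscillation [om] of [g / g0]. *)
Lemma monte_carlo_ratio {d} {T : measurableType d} {R : realType}
    (mu : set T -> \bar R) (P : probability T R) N (g g0 : T -> R) (lo B om : R) :
  represents mu P -> (0 < N)%N -> bdd_mfun g -> bdd_mfun g0 -> 0 < lo ->
  (forall x, lo <= g0 x) -> (forall x y, g0 x <= B * g0 y) ->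
  (forall x y, g x / g0 x - g y / g0 y <= om) ->
  exists PN : probability (N.-tuple T) R, represents (iid_law N mu) PN /\
    bdd_mfun (fun z : N.-tuple T => tuple_sum g z / tuple_sum g0 z) /\
    \int[PN]_z `|\int[P]_x g x / \int[P]_x g0 x - tuple_sum g z / tuple_sum g0 z|
      <= B ^+ 2 * om / Num.sqrt N%:R.
Proof.
move=> muP N_gt0 bg bg0 lo0 log0 g0B om_bound.
have [PN [rPN mom]] := iid_law_represents mu P muP N.
exists PN; split => //.
have g0_gt0 x : 0 < g0 x := lt_le_trans lo0 (log0 x).
have x0 : T := point.
have om0 : 0 <= om by have := om_bound x0 x0; rewrite subrr.
have B0 : 0 < B.
  by have := lt_le_trans (g0_gt0 x0) (g0B x0 x0); rewrite pmulr_lgt0.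
set a := \int[P]_x g0 x; set th := _ / a.
have g0a x : g0 x <= B * a.
  rewrite -[leLHS](probability_Rintegral_cst P) -RintegralZ_bdd//.
  by apply: le_Rintegral_bdd => //; [exact: bdd_mfun_cst|exact: bdd_mfunZ].
have ag0 x : a <= B * g0 x.
  rewrite -[leRHS](probability_Rintegral_cst P).
  by apply: le_Rintegral_bdd => //; exact: bdd_mfun_cst.
have a0 : 0 < a.
  by have := lt_le_trans (g0_gt0 x0) (g0a x0); rewrite pmulr_rgt0.
(* [th] is an average of [g / g0] with weights [g0], hence within [om] of each of its values. *)
have th_le x : th <= g x / g0 x + om.
  rewrite ler_pdivrMr// -RintegralZ_bdd//.
  apply: le_Rintegral_bdd => //; first exact: bdd_mfunZ.
  move=> y; rewrite -ler_pdivrMr//.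
  by have := om_bound y x; lra.
have th_ge x : g x / g0 x - om <= th.
  rewrite ler_pdivlMr// -RintegralZ_bdd//.
  apply: le_Rintegral_bdd => //; first exact: bdd_mfunZ.
  move=> y; rewrite -ler_pdivlMr//.
  by have := om_bound x y; lra.
pose phi x := g x - th * g0 x.
have bphi : bdd_mfun phi by apply: bdd_mfunB => //; exact: bdd_mfunZ.
have phi0 : \int[P]_x phi x = 0.
  rewrite RintegralB_bdd//; last exact: bdd_mfunZ.
  by rewrite RintegralZ_bdd// /th divfK ?subrr// gt_eqF.
have phi_le x : `|phi x| <= om * B * a.
  have -> : phi x = (g x / g0 x - th) * g0 x.
    by rewrite mulrBl divfK// gt_eqF.
  rewrite normrM (gtr0_norm (g0_gt0 x)) -mulrA ler_pM//; first exact: ltW.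
  by rewrite ler_norml; have := th_le x; have := th_ge x; lra.
have [_ S2] := mom phi bphi phi0.
have nN : 0 < N%:R :> R by rewrite ltr0n.
have sN : 0 < Num.sqrt N%:R :> R by rewrite sqrtr_gt0.
have sumg0_ge (z : N.-tuple T) : N%:R * lo <= tuple_sum g0 z.
  rewrite /tuple_sum mulr_natl -[N in leLHS]card_ord -sumr_const.
  exact: ler_sum.
have sumg0_gea (z : N.-tuple T) : N%:R * a <= B * tuple_sum g0 z.
  rewrite /tuple_sum mulr_natl -[N in leLHS]card_ord -sumr_const mulr_sumr.
  exact: ler_sum.
have bratio : bdd_mfun (fun z : N.-tuple T => tuple_sum g z / tuple_sum g0 z).
  apply: bdd_mfunM; first exact: bdd_mfun_tuple_sum.
  apply: (bdd_mfunV (N%:R * lo)) => //; first exact: mulr_gt0.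
  exact: bdd_mfun_tuple_sum.
split => //.
(* Replacing the random denominator by its lower bound leaves a multiple of a centred sum, whose
   second moment is known. *)
pose X (z : N.-tuple T) := (B / (N%:R * a)) * tuple_sum phi z.
have bX : bdd_mfun X by apply: bdd_mfunZ; exact: bdd_mfun_tuple_sum.
apply: (@le_trans _ _ (\int[PN]_z `|X z|)).
  apply: le_Rintegral_bdd.
  - by apply: bdd_mfun_norm; apply: bdd_mfunB => //; exact: bdd_mfun_cst.
  - exact: bdd_mfun_norm.
  move=> z; have s0 : 0 < tuple_sum g0 z.
    by apply: lt_le_trans (sumg0_ge z); exact: mulr_gt0.
  have -> : th - tuple_sum g z / tuple_sum g0 z =
      - tuple_sum phi z / tuple_sum g0 z.
    have -> : tuple_sum phi z = tuple_sum g z - th * tuple_sum g0 z.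
      by rewrite /tuple_sum mulr_sumr -sumrB.
    by field; rewrite gt_eqF.
  rewrite /X !normrM normrN !normfV mulrC ler_wpM2r//.
  have Na : 0 < N%:R * a by rewrite mulr_gt0.
  rewrite (gtr0_norm s0) (gtr0_norm B0) (gtr0_norm Na).
  by rewrite -[leLHS]div1r ler_pdivrMr// mulrAC ler_pdivlMr// mul1r.
apply: (mean_abs_le_sqrt PN X) => //; last first.
  by rewrite !mulr_ge0 ?invr_ge0 ?exprn_ge0// ltW.
have bphi2 : bdd_mfun (fun x => phi x ^+ 2).
  by under eq_fun do rewrite expr2; exact: bdd_mfunM.
rewrite /X; under eq_Rintegral do rewrite exprMn.
rewrite RintegralZ_bdd; last first.
  by under eq_fun do rewrite expr2; apply: bdd_mfunM; exact: bdd_mfun_tuple_sum.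
rewrite S2.
have V2 : \int[P]_x phi x ^+ 2 <= (om * B * a) ^+ 2.
  rewrite -[leRHS](probability_Rintegral_cst P).
  apply: le_Rintegral_bdd => //; first exact: bdd_mfun_cst.
  move=> x; rewrite -real_normK ?num_real// ler_pXn2r// nnegrE.
  by rewrite !mulr_ge0// ltW.
have -> : (B ^+ 2 * om / Num.sqrt N%:R) ^+ 2 =
    (B / (N%:R * a)) ^+ 2 * (N%:R * (om * B * a) ^+ 2).
  rewrite expr_div_n sqr_sqrtr ?ler0n//.
  by field; rewrite !gt_eqF.
by rewrite ler_wpM2l ?sqr_ge0// ler_wpM2l.
Qed.

(** * Probabilities with a density, Gibbs transforms and empirical measures *)

Section MeasureTransforms.
Context {d} {T : measurableType d} {R : realType}.
Local Open Scope ereal_scope.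

(** Adding a bound of [f] makes it nonnegative and shifts both sides by the same constant. *)
Lemma Rintegral_bdd_ext (nu : probability T R) (L : (T -> R) -> R) :
  (forall f, bdd_mfun f -> (forall x, 0 <= f x)%R -> (\int[nu]_x f x)%R = L f) ->
  (forall f M, bdd_mfun f -> L (fun x => f x + M)%R = (L f + M)%R) ->
  forall f, bdd_mfun f -> (\int[nu]_x f x)%R = L f.
Proof.
move=> Lge0 LD f bf; have [M fM] := bf.2.
apply: (@addIr _ M); rewrite -LD// -Lge0.
- rewrite RintegralD_bdd//; last exact: bdd_mfun_cst.
  by rewrite probability_Rintegral_cst.
- by apply: bdd_mfunD => //; exact: bdd_mfun_cst.
- by move=> x; have := fM x; rewrite ler_norml => /andP[+ _]; lra.
Qed.

Section WeightedDirac.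
Variables (G : T -> R) (G_ge0 : forall x, (0 <= G x)%R) (G_bdd : bdd_mfun G).

(** The mixture of these kernels over [P] is the measure with density [G] with respect to [P]. *)
Definition weighted_dirac of bdd_mfun G := fun x : T =>
  mscale (NngNum (G_ge0 x)) (\d_x) : {measure set T -> \bar R}.

Let weighted_diracE x A : weighted_dirac G_bdd x A = (G x)%:E * (\d_x)%R A.
Proof. by []. Qed.

Let weighted_dirac_measurable U : measurable U ->
  measurable_fun setT ((weighted_dirac G_bdd) ^~ U).
Proof.
move=> mU; apply: emeasurable_funM; first by apply/measurable_EFinP; case: G_bdd.
exact: measurable_fun_dirac.
Qed.

HB.instance Definition _ := isKernel.Build _ _ _ _ R (weighted_dirac G_bdd)
  weighted_dirac_measurable.

Let weighted_dirac_uub : measure_fam_uub (weighted_dirac G_bdd).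
Proof.
have [M GM] := G_bdd.2; exists (M + 1)%R => x.
rewrite weighted_diracE diracT mule1 lte_fin.
by have := GM x; rewrite ler_norml => /andP[_]; lra.
Qed.

HB.instance Definition _ := Kernel_isFinite.Build _ _ _ _ R
  (weighted_dirac G_bdd) weighted_dirac_uub.

Lemma density_exists (P : probability T R) : (\int[P]_x G x = 1)%R ->
  exists nu : probability T R,
    (forall A, measurable A -> nu A = \int[P]_(x in A) (G x)%:E) /\
    forall f, bdd_mfun f -> (\int[nu]_x f x)%R = (\int[P]_x (G x * f x))%R.
Proof.
move=> G1.
have mass1 : \int[P]_x weighted_dirac G_bdd x setT = 1.
  under eq_integral do rewrite weighted_diracE diracT mule1.
  by rewrite bdd_mfun_EFin// G1.
have [nu [nuE nuint]] := mixture_exists P (weighted_dirac G_bdd) mass1.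
exists nu; split=> [A mA|].
  rewrite nuE [RHS]integral_mkcond; apply: eq_integral => x _.
  rewrite weighted_diracE diracE patchE.
  by case: ifP => _; rewrite ?mule1 ?mule0.
apply: Rintegral_bdd_ext => [f bf f0|f M bf].
  congr fine; rewrite nuint//; last by apply/measurable_EFinP; case: bf.
  apply: eq_integral => x _; rewrite ge0_integral_mscale//.
  - by rewrite integral_dirac//=; [rewrite diracT mul1e|apply/measurable_EFinP; case: bf].
  - by apply/measurable_EFinP; case: bf.
  - by move=> y _; rewrite lee_fin.
rewrite [LHS](eq_Rintegral _ (g := fun x => G x * f x + M * G x)%R);
  last by move=> x _; rewrite mulrDr (mulrC _ M).
rewrite RintegralD_bdd; [|exact: bdd_mfunM|exact: bdd_mfunZ].
by rewrite RintegralZ_bdd// G1 mulr1.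
Qed.

End WeightedDirac.

Lemma gibbs_represents (mu : set T -> \bar R) (P : probability T R) g (lo : R) :
  represents mu P -> bdd_mfun g -> (0 < lo)%R -> (forall x, lo <= g x)%R ->
  exists P' : probability T R, represents (gibbs g mu) P' /\
    forall f, bdd_mfun f ->
      (\int[P']_x f x = (\int[P]_x (g x * f x)) / (\int[P]_x g x))%R.
Proof.
move=> muP bg lo0 log; pose c := (\int[P]_x g x)%R.
have c0 : (0 < c)%R.
  apply: lt_le_trans lo0 _; rewrite -[leLHS](probability_Rintegral_cst P).
  by apply: le_Rintegral_bdd => //; exact: bdd_mfun_cst.
have g0 x : (0 <= g x)%R := le_trans (ltW lo0) (log x).
pose G x := (c^-1 * g x)%R.
have G0 x : (0 <= G x)%R by rewrite mulr_ge0// invr_ge0 ltW.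
have bG : bdd_mfun G by exact: bdd_mfunZ.
have G1 : (\int[P]_x G x = 1)%R by rewrite RintegralZ_bdd// mulVf// gt_eqF.
have [P' [P'E P'int]] := density_exists G G0 bG P G1.
exists P'; split=> [A mA|f bf].
  rewrite P'E// /gibbs !(integral_represents _ _ _ _ muP).
  under [RHS]eq_integral do rewrite EFinM.
  rewrite ge0_integralZl//.
  - by apply/measurable_EFinP; apply: measurable_funTS; case: bg.
  - by move=> x _; rewrite lee_fin.
  - by rewrite lee_fin invr_ge0 ltW.
rewrite P'int//; under eq_Rintegral do rewrite -mulrA.
by rewrite RintegralZ_bdd 1?[RHS]mulrC//; exact: bdd_mfunM.
Qed.

Lemma empirical_represents N (z : N.-tuple T) : (0 < N)%N ->
  exists P : probability T R, represents (empirical z) P /\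
    forall f, bdd_mfun f -> (\int[P]_x f x = N%:R^-1 * tuple_sum f z)%R.
Proof.
move=> N0; pose x0 := nth point z.
have Nr : (0 <= N%:R^-1 :> R)%R by rewrite invr_ge0.
pose m : {measure set T -> \bar R} :=
  mscale (NngNum Nr) (msum (fun i => \d_(nth point z i) : {measure set T -> \bar R}) N).
have mE A : m A = empirical z A.
  rewrite /m /mscale /= /msum /empirical; congr (_ * _).
  by apply: eq_bigr => i _; rewrite (tnth_nth point).
have m1 : m setT = 1.
  rewrite mE /empirical; under eq_bigr do rewrite diracT.
  by rewrite sumEFin sumr_const card_ord -EFinM mulVf// pnatr_eq0 -lt0n.
exists (probability_of_measure m m1); split=> [A _|]; first by rewrite -mE.
apply: Rintegral_bdd_ext => [f bf f0|f M bf]; last first.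
  rewrite /tuple_sum big_split/= sumr_const card_ord mulrDr -(mulr_natl M) mulrA.
  by rewrite mulVf ?mul1r// pnatr_eq0 -lt0n.
have mf : measurable_fun setT (fun x => (f x)%:E).
  by apply/measurable_EFinP; case: bf.
apply: EFin_inj; rewrite -bdd_mfun_EFin//.
rewrite [LHS](_ : _ = \int[m]_x (f x)%:E)// ge0_integral_mscale//; last first.
  by move=> x _; rewrite lee_fin.
rewrite ge0_integral_measure_sum//; last by move=> x _; rewrite lee_fin.
rewrite EFinM; congr (_ * _); rewrite /tuple_sum -sumEFin.
apply: eq_bigr => i _; rewrite integral_dirac// diracT mul1e.
by rewrite (tnth_nth point).
Qed.

End MeasureTransforms.

(** * Propagation of the error through the particle system *)

Section ParticleSystem.
Context {d} {E : measurableType d} {R : realType}.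
Variables (x0 : E) (Q : nat -> R.-pker E ~> E) (Psi : seq E -> R).
Variable zeta : probability E R.
Variable PsiT : forall n, n.+1.-tuple E -> R.
Arguments PsiT {n}.
Hypothesis PsiTE : forall n (t : n.+2.-tuple E), PsiT t = Psi t.
Hypothesis Psi_path : path_mfun Psi.
Variables lo hi : R.
Hypothesis lo_gt0 : 0 < lo.
Hypothesis Psi_bounds : forall s, lo <= Psi s <= hi.

Local Notation step := (fk_step x0 Q Psi).

Lemma endpoint_last n (t : n.+1.-tuple E) : endpoint t = last x0 t.
Proof.
by rewrite /endpoint (tnth_nth x0)/= (last_nth x0) size_tuple; case: t => -[].
Qed.

Lemma measurable_extend n (t : n.+1.-tuple E) : measurable_fun setT (extend t).
Proof.
have mp : measurable_fun setT (fun x : E => (t, x)) by exact: measurable_fun_pair.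
exact: measurableT_comp (measurable_rcons_tuple n.+1) mp.
Qed.

Definition extend_mfun n (t : n.+1.-tuple E) : {mfun E >-> n.+2.-tuple E} :=
  HB.pack (extend t) (isMeasurableFun.Build _ _ _ _ _ (measurable_extend n t)).

Definition extension_kernel n (t : n.+1.-tuple E) :
    {measure set (n.+2.-tuple E) -> \bar R} :=
  distribution (transition Q n.+1 (last x0 t)) (extend_mfun n t).

Let extension_kernel_measurable n U : measurable U ->
  measurable_fun setT ((extension_kernel n) ^~ U).
Proof.
move=> mU.
pose V := (fun tx : n.+1.-tuple E * E => extend tx.1 tx.2) @^-1` U.
have mV : measurable V.
  by rewrite /V -[_ @^-1` _]setTI; exact: (measurable_rcons_tuple n.+1 measurableT).
have := measurable_fun_xsection_finite_kernel (last_kernel x0 Q n) (mem_set mV).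
congr measurable_fun; apply/funext => t.
rewrite /extension_kernel /distribution /pushforward /last_kernel /=.
by congr (Q _ _ _); apply/seteqP; split=> x /=; rewrite /xsection /= in_setE.
Qed.

HB.instance Definition _ n := isKernel.Build _ _ _ _ R (extension_kernel n)
  (extension_kernel_measurable n).

Let extension_kernel_uub n : measure_fam_uub (extension_kernel n).
Proof.
exists 2%R => t; rewrite [X in (X < _)%E](_ : _ = 1%E) ?lte_fin ?ltr1n//.
exact: (probability_setT (distribution (transition Q n.+1 (last x0 t)) (extend_mfun n t))).
Qed.

HB.instance Definition _ n := Kernel_isFinite.Build _ _ _ _ R
  (extension_kernel n) (extension_kernel_uub n).

(** The last clause is what turns one step of the algorithm into one application of [fk_step];
    signed [F] are reached by adding a bound. *)
Lemma Qbar_act_represents n (mu : set (n.+1.-tuple E) -> \bar R) P :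
  represents mu P ->
  exists eta : probability (n.+2.-tuple E) R, [/\ represents (Qbar_act Q mu) eta,
    (forall f, (forall t, 0 <= f t)%E -> measurable_fun setT f ->
      \int[eta]_t f t =
      \int[P]_t \int[Q n.+1 (endpoint t)]_x f (extend t x))%E &
    forall F, path_mfun F ->
      \int[eta]_t (Psi t * F t) = \int[P]_t step F t].
Proof.
move=> muP.
have mass1 : (\int[P]_t extension_kernel n t setT = 1)%E.
  transitivity (\int[P]_(t in setT) (cst 1 t))%E.
    apply: eq_integral => t _.
    exact: (probability_setT (distribution (transition Q n.+1 (last x0 t)) (extend_mfun n t))).
  by rewrite integral_cst// mul1e; exact: probability_setT.
have [eta [etaE etaint]] := mixture_exists P (extension_kernel n) mass1.
have ge0 (f : n.+2.-tuple E -> \bar R) : (forall t, 0 <= f t)%E ->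
    measurable_fun setT f -> (\int[eta]_t f t =
      \int[P]_t \int[Q n.+1 (endpoint t)]_x f (extend t x))%E.
  move=> f0 mf; rewrite etaint//; apply: eq_integral => t _.
  rewrite /extension_kernel ge0_integral_distribution//=.
  by rewrite endpoint_last.
exists eta; split=> [A mA|//|F mF].
  rewrite etaE /Qbar_act (integral_represents _ _ _ _ muP).
  by apply: eq_integral => t _; rewrite /Qbar endpoint_last.
have bG := path_mfun_tuple _ n.+1 (path_mfunM _ _ Psi_path mF).
have [M GM] := bG.2.
have mGM : bdd_mfun (fun t : n.+2.-tuple E => Psi t * F t + M).
  by apply: bdd_mfunD => //; exact: bdd_mfun_cst.
have GM0 (t : n.+2.-tuple E) : 0 <= Psi t * F t + M.
  by have := GM t; rewrite ler_norml => /andP[+ _]; lra.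
apply: (@addIr _ M).
rewrite -{1}(probability_Rintegral_cst eta M) -RintegralD_bdd//; last exact: bdd_mfun_cst.
rewrite -{2}(probability_Rintegral_cst P M) -RintegralD_bdd//; last 2 first.
- exact: (path_mfun_tuple _ n (path_mfun_step x0 Q Psi Psi_path F mF)).
- exact: bdd_mfun_cst.
congr fine; rewrite ge0; [|by move=> t; rewrite lee_fin|]; last first.
  by apply/measurable_EFinP; case: mGM.
apply: eq_integral => t _.
rewrite /fk_step size_tuple endpoint_last.
have bI : bdd_mfun (fun x => Psi (extend t x) * F (extend t x)).
  exact: (bdd_mfun_comp _ _ bG (measurable_extend n t)).
set P' := transition _ _ _.
have := bdd_mfun_EFin P' (fun x => Psi (extend t x) * F (extend t x) + M).
rewrite RintegralD_bdd//; last exact: bdd_mfun_cst.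
rewrite probability_Rintegral_cst; apply.
by apply: bdd_mfunD => //; exact: bdd_mfun_cst.
Qed.

Lemma Psi_iter_bdd n j F : path_mfun F ->
  bdd_mfun (fun t : n.+1.-tuple E => Psi t * iter j step F t).
Proof.
move=> mF; apply: (path_mfun_tuple (fun s => Psi s * iter j step F s)).
by apply: path_mfunM => //; exact: path_mfun_iter.
Qed.

(** The integral of [F] after [j] exact steps started from [mu], written backwards so that [mu]
    enters only through two integrals. *)
Definition fk_val j (F : seq E -> R) {n} (mu : set (n.+1.-tuple E) -> \bar R) : R :=
  fine (\int[mu]_t (iter j step F t)%:E)%E /
  fine (\int[mu]_t (iter j step (fun=> 1) t)%:E)%E.

Lemma fk_valE j F n (mu : set (n.+1.-tuple E) -> \bar R) P : represents mu P ->
  fk_val j F mu =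
  (\int[P]_t iter j step F t) / (\int[P]_t iter j step (fun=> 1) t).
Proof. by move=> muP; rewrite /fk_val !(integral_represents _ _ _ _ muP). Qed.

Lemma fk_val0 F n (mu : set (n.+1.-tuple E) -> \bar R) P : represents mu P ->
  fk_val 0 F mu = \int[P]_t F t.
Proof.
by move=> muP; rewrite (fk_valE _ _ _ _ _ muP)/= probability_Rintegral_cst divr1.
Qed.

Lemma Rintegral_Psi_gt0 n (P : probability (n.+1.-tuple E) R) :
  0 < \int[P]_t Psi t.
Proof.
apply: lt_le_trans lo_gt0 _; rewrite -[leLHS](probability_Rintegral_cst P).
apply: le_Rintegral_bdd; [exact: bdd_mfun_cst|exact: path_mfun_tuple|].
by move=> t; case/andP: (Psi_bounds t).
Qed.

(** Hence the exact step and the particle step differ only by the sampling between [Qbar_act] and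
    [gibbs]. *)
Lemma Rop_gibbs n (mu : set (n.+1.-tuple E) -> \bar R) P A :
  represents mu P -> measurable A ->
  Rop Q (@PsiT) mu A = gibbs (@PsiT n.+1) (Qbar_act Q mu) A.
Proof.
move=> muP mA.
have [eta [reta etaint _]] := Qbar_act_represents n mu P muP.
have mPsi : measurable_fun setT (fun t : n.+2.-tuple E => Psi t).
  by have [+ _] := Psi_path; exact.
have Psi0 t : 0 <= Psi t.
  by have /andP[+ _] := Psi_bounds t; apply: le_trans; exact: ltW.
have gE B : measurable B ->
    gammaop Q (@PsiT) mu B = (\int[Qbar_act Q mu]_(t in B) (PsiT t)%:E)%E.
  move=> mB; rewrite (integral_represents _ _ _ _ reta) integral_mkcond.
  rewrite [RHS](_ : _ = \int[eta]_t (Psi t * \1_B t)%:E)%E.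
    rewrite etaint.
    - rewrite /gammaop (integral_represents _ _ _ _ muP).
      apply: eq_integral => t _; apply: eq_integral => x _.
      by rewrite PsiTE.
    - by move=> t; rewrite lee_fin mulr_ge0.
    - by apply/measurable_EFinP/measurable_funM.
  apply: eq_integral => t _; rewrite patchE indicE PsiTE.
  by case: ifP => _; rewrite ?mulr1 ?mulr0.
by rewrite /Rop /gibbs !gE.
Qed.

Lemma fk_val_gibbs j F n (mu nu : set (n.+1.-tuple E) -> \bar R) P P' :
  path_mfun F -> represents mu P -> represents nu P' ->
  (forall G, path_mfun G -> \int[P']_t G t =
     (\int[P]_t (Psi t * G t)) / (\int[P]_t Psi t)) ->
  fk_val j F nu =
  (\int[P]_t (Psi t * iter j step F t)) /
  (\int[P]_t (Psi t * iter j step (fun=> 1) t)).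
Proof.
move=> mF muP nuP' P'E.
have mi G : path_mfun G -> path_mfun (iter j step G).
  by move=> mG; exact: path_mfun_iter.
have m1 := path_mfun_cst (E := E) (1 : R).
rewrite (fk_valE _ _ _ _ _ nuP') !P'E//; [|exact: mi|exact: mi].
have c0 := Rintegral_Psi_gt0 n P.
by rewrite invf_div mulrA divfK// gt_eqF.
Qed.

Lemma initial_law_represents :
  exists P, represents (@initial_law R d E zeta) P.
Proof.
have mt : measurable_fun setT (fun x : E => [tuple x]).
  apply/measurable_fun_tnthP => i; rewrite (ord1 i).
  by rewrite (_ : _ \o _ = id).
have rz : represents zeta zeta by [].
by have [P [rP _]] := represents_pushforward _ _ _ rz mt; exists P.
Qed.

(** An exact step moves one unit from the time already run to the time still to run; the normalising
    constants cancel in the ratio. *)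
Lemma Rflow_represents n : (exists P, represents (Rflow zeta Q (@PsiT) n) P) /\
  forall j F, path_mfun F ->
  fk_val j F (Rflow zeta Q (@PsiT) n) = fk_val (j + n) F (@initial_law R d E zeta).
Proof.
elim: n => [|n [[P rP] IH]].
  split=> [|j F _]; first exact: initial_law_represents.
  by rewrite addn0.
have [eta [reta _ etaE]] := Qbar_act_represents n _ P rP.
have bPsi : bdd_mfun (@PsiT n.+1).
  have -> : @PsiT n.+1 = (fun t : n.+2.-tuple E => Psi t) by apply/funext => t.
  exact: path_mfun_tuple.
have loPsi (t : n.+2.-tuple E) : lo <= PsiT t.
  by rewrite PsiTE; case/andP: (Psi_bounds t).
have [P' [rP' P'E]] := gibbs_represents _ _ _ lo reta bPsi lo_gt0 loPsi.
have rR : represents (Rflow zeta Q (@PsiT) n.+1) P'.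
  by move=> A mA; rewrite -rP'//=; exact: (Rop_gibbs _ _ _ _ rP).
split=> [|j F mF]; first by exists P'.
rewrite (fk_val_gibbs _ _ _ _ _ _ _ mF reta rR) => [|G mG]; last first.
  rewrite P'E; last exact: path_mfun_tuple.
  by congr (_ / _); apply: eq_Rintegral => t _; rewrite PsiTE.
have m1 := path_mfun_cst (E := E) (1 : R).
rewrite !etaE; [|exact: path_mfun_iter|exact: path_mfun_iter].
by rewrite -addSnnS -IH// (fk_valE _ _ _ _ _ rP).
Qed.

Lemma gibbs_empirical_represents n N (z : N.-tuple (n.+2.-tuple E)) : (0 < N)%N ->
  exists P, represents (gibbs (@PsiT n.+1) (empirical z)) P /\
  forall j F, path_mfun F ->
    fk_val j F (gibbs (@PsiT n.+1) (empirical z)) =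
    tuple_sum (fun t : n.+2.-tuple E => Psi t * iter j step F t) z /
    tuple_sum (fun t : n.+2.-tuple E => Psi t * iter j step (fun=> 1) t) z.
Proof.
move=> N_gt0.
have [eta [reta etaE]] := @empirical_represents _ _ R N z N_gt0.
have bPsi : bdd_mfun (@PsiT n.+1).
  have -> : @PsiT n.+1 = (fun t : n.+2.-tuple E => Psi t) by apply/funext => t.
  exact: path_mfun_tuple.
have loPsi (t : n.+2.-tuple E) : lo <= PsiT t.
  by rewrite PsiTE; case/andP: (Psi_bounds t).
have [P [rP PE]] := gibbs_represents _ _ _ lo reta bPsi lo_gt0 loPsi.
exists P; split => // j F mF.
rewrite (fk_val_gibbs _ _ _ _ _ _ _ mF reta rP) => [|G mG]; last first.
  rewrite PE; last exact: path_mfun_tuple.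
  by congr (_ / _); apply: eq_Rintegral => t _; rewrite PsiTE.
have m1 := path_mfun_cst (E := E) (1 : R).
have b G : path_mfun G -> bdd_mfun (fun t : n.+2.-tuple E => Psi t * iter j step G t).
  exact: Psi_iter_bdd.
rewrite (etaE _ (b _ mF)) (etaE _ (b _ m1)) invfM invrK mulrACA.
by rewrite mulVf ?mul1r// pnatr_eq0 -lt0n.
Qed.

(** The algorithm visits only represented measures, so a comparison there suffices. Nonnegativity is
    part of the conclusion because the induction, through lower integrals, needs it at the preceding
    step. *)
Lemma expect_particles_le N n
    (H H' : (set (n.+1.-tuple E) -> \bar R) -> \bar R) : (0 < N)%N ->
  (forall mu, (exists P, represents mu P) -> 0 <= H mu /\ H mu <= H' mu)%E ->
  (0 <= expect_particles zeta Q (@PsiT) N n H /\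
   expect_particles zeta Q (@PsiT) N n H <=
   expect_particles zeta Q (@PsiT) N n H')%E.
Proof.
move=> N_gt0; elim: n H H' => [|n IH] H H' HH'.
  exact/HH'/initial_law_represents.
apply: IH => mu [P rP].
have [eta [reta _ _]] := Qbar_act_represents n _ P rP.
have [PN [rPN _]] := iid_law_represents _ _ reta N.
have g z : (0 <= H (gibbs (@PsiT n.+1) (empirical z)) /\
    H (gibbs (@PsiT n.+1) (empirical z)) <=
    H' (gibbs (@PsiT n.+1) (empirical (z : N.-tuple _))))%E.
  by apply: HH'; have [P' [rP' _]] := gibbs_empirical_represents n N z N_gt0; exists P'.
rewrite !(integral_represents _ _ _ _ rPN); split.
  by apply: integral_ge0 => z _; case: (g z).
by apply: ge0_le_integral_lower => z; case: (g z).
Qed.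

Variables K tau kap : R.
Hypothesis K_ge0 : 0 <= K.
Hypothesis tau_gt0 : 0 < tau.
Hypothesis tau_lt1 : tau < 1.
Hypothesis kap_ge1 : 1 <= kap.
Hypothesis Psi_agree : forall j s t, (0 < j)%N -> agree j s t ->
  Psi s <= expR (K * tau ^+ j) * Psi t.
Hypothesis Q_compare : forall n l l' A, (0 < n)%N -> measurable A ->
  (Q n l A <= kap%:E * Q n l' A)%E.
Variable b : nat -> R.
Hypothesis b0_ge1 : 1 <= b 0%N.
Hypothesis b_rec : forall L, (0 < L)%N -> 1 <= b L \/ exists m, (0 < m <= L)%N /\
  (1 - (forget_const K tau kap)^-1) * b (L - m)%N
    + 2 * memory_rate K tau * tau ^+ m <= b L.

(** Bounds the ratio of the total weights of two particles: [hi / lo] for the current potential, the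
    rest for the mass of the future, started from unrelated paths. *)
Definition weight_ratio := hi / lo * (kap * expR (memory_rate K tau)).

Section LocalError.
Variables (p : nat) (F : seq E -> R).
Hypothesis F_path : path_mfun F.
Hypothesis F01 : forall t, 0 <= F t <= 1.
Hypothesis F_recent : forall t t', agree p t t' -> F t = F t'.

Let m1 : path_mfun (fun=> 1 : R) := path_mfun_cst (E := E) (1 : R).

(** The error made by resampling [j] steps before the final time. By truncated subtraction there is
    no decay during the last [p] steps, where [F] looks directly. *)
Definition local_error N j := weight_ratio ^+ 2 * b (j - p)%N / Num.sqrt N%:R.

Lemma fk_ratio_osc_sub j s s' : (0 < size s)%N -> size s = size s' ->
  fk_ratio x0 Q Psi j F s' - fk_ratio x0 Q Psi j F s <= b (j - p)%N.
Proof.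
move=> s_gt0 ss; have [jp|pj] := ltnP j p; last first.
  apply: (fk_ratio_osc x0 Q Psi Psi_path lo hi lo_gt0 Psi_bounds K tau kap
    K_ge0 tau_gt0 tau_lt1 kap_ge1 Psi_agree Q_compare p F F_path F01 F_recent
    b b0_ge1 b_rec) => //.
  by rewrite subnKC.
have -> : (j - p = 0)%N by lia.
have bd := fk_ratio_bounds x0 Q Psi Psi_path lo hi lo_gt0 Psi_bounds.
have /andP[_ h1] := bd j 0 1 F s' F_path (fun t _ => F01 t).
have /andP[h2 _] := bd j 0 1 F s F_path (fun t _ => F01 t).
by rewrite (le_trans _ b0_ge1)// lerBlDr (le_trans h1)// lerDl.
Qed.

(** [V] is a fixed target. The right side has the shape of the integrand, with one more exact step
    and a larger constant, so the estimate can be iterated by monotonicity. *)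
Lemma particle_step_error n N j (mu : set (n.+1.-tuple E) -> \bar R) P V a C :
  (0 < N)%N -> represents mu P -> 0 <= a ->
  (\int[iid_law N (Qbar_act Q mu)]_z
     (a * `|V - fk_val j F (gibbs (@PsiT n.+1) (empirical z))| + C)%:E
   <= (a * `|V - fk_val j.+1 F mu| + (C + a * local_error N j))%:E)%E.
Proof.
move=> N_gt0 rP a0.
have [eta [reta _ etaE]] := Qbar_act_represents n _ P rP.
pose g (t : n.+2.-tuple E) := Psi t * iter j step F t.
pose g0 (t : n.+2.-tuple E) := Psi t * iter j step (fun=> 1) t.
have bg : bdd_mfun g.
  exact: Psi_iter_bdd.
have bg0 : bdd_mfun g0.
  exact: Psi_iter_bdd.
have Psi_gt0 t : 0 < Psi t.
  by have /andP[+ _] := Psi_bounds t; exact: lt_le_trans.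
have i1 s : 0 < iter j step (fun=> 1) s.
  exact: (fk_iter1_gt0 x0 Q Psi Psi_path lo hi lo_gt0 Psi_bounds).
have g0_ge t : lo * lo ^+ j <= g0 t.
  rewrite ler_pM ?exprn_ge0 ?(ltW lo_gt0)//; first by case/andP: (Psi_bounds t).
  exact: (fk_iter1_ge x0 Q Psi Psi_path lo hi lo_gt0 Psi_bounds).
have hi0 : 0 < hi.
  by have /andP[h1 h2] := Psi_bounds [::]; exact: lt_le_trans (le_trans h1 h2).
have g0_ratio t t' : g0 t <= weight_ratio * g0 t'.
  rewrite /weight_ratio /g0 mulrACA; apply: ler_pM; rewrite ?(ltW (Psi_gt0 _)) ?(ltW (i1 _))//.
    apply: (@le_trans _ _ hi); first by case/andP: (Psi_bounds t).
    rewrite mulrAC ler_pdivlMr// ler_pM2l//.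
    by case/andP: (Psi_bounds t').
  have := fk_compare x0 Q Psi Psi_path lo hi lo_gt0 Psi_bounds K tau kap
    K_ge0 tau_gt0 tau_lt1 kap_ge1 Psi_agree Q_compare j 0%N t t' _ _ m1 m1.
  rewrite expr0 mulr1; apply=> //; first by rewrite size_tuple.
  by apply: agree0; rewrite !size_tuple.
(* The potential cancels, and the oscillation to be controlled is that of [fk_ratio]. *)
have g_ratio t t' : g t / g0 t - g t' / g0 t' <= b (j - p)%N.
  have e u : g u / g0 u = fk_ratio x0 Q Psi j F u.
    by rewrite /g /g0 /fk_ratio invfM mulrACA divff ?mul1r// gt_eqF.
  by rewrite !e; apply: fk_ratio_osc_sub; rewrite !size_tuple.
have [PN [rPN [bS MC]]] := monte_carlo_ratio _ _ N g g0 _ _ _ reta N_gt0 bg bg0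
  (mulr_gt0 lo_gt0 (exprn_gt0 j lo_gt0)) g0_ge g0_ratio g_ratio.
rewrite (integral_represents _ _ _ _ rPN).
under eq_integral => z _.
  have [_ [_ ->//]] := gibbs_empirical_represents n N z N_gt0.
  over.
rewrite -/g -/g0 /=.
pose X (z : N.-tuple (n.+2.-tuple E)) := tuple_sum g z / tuple_sum g0 z.
have valE : fk_val j.+1 F mu = (\int[eta]_t g t) / (\int[eta]_t g0 t).
  by rewrite (fk_valE _ _ _ _ _ rP) !etaE//; exact: path_mfun_iter.
rewrite valE; move: MC; set W := _ / _ => MC.
have bW c : bdd_mfun (fun z => c - X z).
  by apply: bdd_mfunB => //; exact: bdd_mfun_cst.
have bn c := bdd_mfun_norm _ (bW c).
rewrite [leLHS](bdd_mfun_EFin PN (fun z => a * `|V - X z| + C)); last first.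
  by apply: bdd_mfunD; [exact: bdd_mfunZ|exact: bdd_mfun_cst].
rewrite lee_fin RintegralD_bdd; [|exact: bdd_mfunZ|exact: bdd_mfun_cst].
rewrite RintegralZ_bdd// probability_Rintegral_cst (addrC C) addrA lerD2r -mulrDr.
apply: ler_wpM2l => //.
apply: (@le_trans _ _ (\int[PN]_z (`|V - W| + `|W - X z|))).
  apply: le_Rintegral_bdd => //.
    by apply: bdd_mfunD => //; exact: bdd_mfun_cst.
  by move=> z; rewrite -[X in `|X| <= _](subrKA W) ler_normD.
rewrite RintegralD_bdd//; last exact: bdd_mfun_cst.
by rewrite probability_Rintegral_cst lerD2l.
Qed.

(** The innermost integral of [expect_particles] is the last particle step; each induction step
    replaces it by an exact one, until only the initial law is left. *)
Lemma expect_particles_fk_val N k j V a C : (0 < N)%N -> 0 <= a -> 0 <= C ->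
  (forall i, 0 <= local_error N i) ->
  (expect_particles zeta Q (@PsiT) N k
     (fun mu => (a * `|V - fk_val j F mu| + C)%:E) <=
   (a * `|V - fk_val (j + k) F (@initial_law R d E zeta)| +
    (C + a * \sum_(i < k) local_error N (j + i)))%:E)%E.
Proof.
move=> N_gt0 a0 + loc0; elim: k j C => [|k IH] j C C0.
  by rewrite /= big_ord0 mulr0 addr0 addn0.
pose H (mu : set (k.+1.-tuple E) -> \bar R) := (\int[iid_law N (Qbar_act Q mu)]_z
     (a * `|V - fk_val j F (gibbs (@PsiT k.+1) (empirical z))| + C)%:E)%E.
pose H' (mu : set (k.+1.-tuple E) -> \bar R) :=
  (a * `|V - fk_val j.+1 F mu| + (C + a * local_error N j))%:E.
have HH' mu : (exists P, represents mu P) -> (0 <= H mu /\ H mu <= H' mu)%E.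
  move=> [P rP]; split; last first.
    have hh := particle_step_error k N j mu P V a C N_gt0 rP a0.
    exact: hh.
  have [eta [reta _ _]] := Qbar_act_represents k _ P rP.
  have [PN [rPN _]] := iid_law_represents _ _ reta N.
  rewrite /H (integral_represents _ _ _ _ rPN).
  by apply: integral_ge0 => z _; rewrite lee_fin addr_ge0// mulr_ge0.
have [_ h] := expect_particles_le N k H H' N_gt0 HH'.
apply: le_trans h _.
apply: le_trans (IH j.+1 _ _) _; first by rewrite addr_ge0// mulr_ge0.
rewrite lee_fin addSnnS lerD2l big_ord_recl addn0 mulrDr addrA.
by under eq_bigr do rewrite addSnnS.
Qed.

End LocalError.

Hypothesis b_ge0 : forall L, 0 <= b L.

Lemma particle_error_le N n p : (0 < N)%N ->
  (particle_error zeta Q (@PsiT) N n p <=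
   (2 * \sum_(i < n) local_error p N i)%:E)%E.
Proof.
move=> N_gt0; apply: ge_ereal_sup => _ [f /= f1 <-].
have fle t : `|f t| <= 1.
  rewrite -lee_fin -f1; apply: ereal_sup_ubound; by exists t.
(* Forgetting is stated for values in [0, 1]; undoing this rescaling of [f] produces the factor
   2. *)
pose F0 (t : n.+1.-tuple E) := (f (last_coords p t) + 1) / 2.
(* Only paths of length [n.+1] matter at the final time; [F] is 0 on the others. *)
pose F (s : seq E) : R := if insub s is Some t then F0 t else 0.
have FE (t : n.+1.-tuple E) : F t = F0 t by rewrite /F valK.
have F01 t : 0 <= F t <= 1.
  rewrite /F; case: insubP => [u _ _|_]; last by rewrite lexx ler01.
  have := fle (last_coords p u); rewrite ler_norml /F0 => /andP[h1 h2].
  by rewrite divr_ge0//= ?ler_pdivrMr//; lra.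
have m_last : measurable_fun setT (fun t : n.+1.-tuple E => last_coords p t).
  apply/measurable_fun_tnthP => i.
  rewrite (_ : _ \o _ = (@tnth _ E ^~ (inord (n.+1 - p + i)))).
    exact: measurable_tnth.
  by apply/funext => t; rewrite /= tnth_mktuple.
have bf : bdd_mfun f by split=> //; exists 1.
have bfl := bdd_mfun_comp f _ bf m_last.
have F_path : path_mfun F.
  split=> [k|]; last by exists 1 => s; rewrite ger0_norm; case/andP: (F01 s).
  have [->|kn] := eqVneq k n.
    rewrite (_ : (fun _ => _) = F0); last by apply/funext => t; rewrite FE.
    apply: measurable_funM => //.
    by apply: measurable_funD => //; case: bfl.
  rewrite (_ : (fun _ => _) = (fun=> 0)); first exact: measurable_cst.
  apply/funext => t; rewrite /F insubF// size_tuple eqSS.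
  exact/negbTE.
have F_recent t t' : agree p t t' -> F t = F t'.
  move=> tt'; have st : size t = size t' by case: tt'.
  rewrite /F; case: insubP => [u /eqP su ut|su]; last by rewrite insubN// -st.
  case: insubP => [u' su' ut'|]; last by rewrite -st su eqxx.
  rewrite /F0; congr ((f _ + 1) / 2); apply: eq_from_tnth => i.
  rewrite !tnth_mktuple !(tnth_nth x0) ut ut'; apply: (agree_nth _ _ _ _ _ tt').
  rewrite su inordK; first exact: leq_addr.
  by have := ltn_ord i; have := geq_minl n.+1 p; have := geq_minr n.+1 p; lia.
have loc0 i : 0 <= local_error p N i.
  by rewrite divr_ge0 ?sqrtr_ge0// mulr_ge0 ?sqr_ge0.
have [[PR rPR] RE] := Rflow_represents n.
pose V := fk_val 0 F (Rflow zeta Q (@PsiT) n).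
have marg (mu : set (n.+1.-tuple E) -> \bar R) P : represents mu P ->
    (\int[marginal p mu]_x (f x)%:E = (2 * fk_val 0 F mu - 1)%:E)%E.
  move=> rP; have [P' [rP' P'E]] := represents_pushforward _ _ _ rP m_last.
  rewrite (integral_represents _ _ _ _ rP') bdd_mfun_EFin// P'E//.
  rewrite (fk_val0 _ _ _ _ rP); congr EFin.
  under [in RHS]eq_Rintegral do rewrite FE /F0 mulrC.
  rewrite RintegralZ_bdd; last by apply: bdd_mfunD => //; exact: bdd_mfun_cst.
  rewrite RintegralD_bdd//; last exact: bdd_mfun_cst.
  by rewrite probability_Rintegral_cst; field.
pose H (mu : set (n.+1.-tuple E) -> \bar R) :=
  `| \int[marginal p (Rflow zeta Q (@PsiT) n)]_x (f x)%:E
     - \int[marginal p mu]_x (f x)%:E |%E.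
pose H' (mu : set (n.+1.-tuple E) -> \bar R) := (2 * `|V - fk_val 0 F mu| + 0)%:E.
have HH' mu : (exists P, represents mu P) -> (0 <= H mu /\ H mu <= H' mu)%E.
  move=> [P rP]; rewrite /H abse_ge0; split => //.
  rewrite (marg _ _ rPR) (marg _ _ rP) -/V -EFinB abse_EFin lee_fin addr0.
  have -> : 2 * V - 1 - (2 * fk_val 0 F mu - 1) = 2 * (V - fk_val 0 F mu) by ring.
  by rewrite normrM ger0_norm.
have [_ h] := expect_particles_le N n H H' N_gt0 HH'.
apply: le_trans h _.
apply: le_trans (expect_particles_fk_val p F F_path F01 F_recent N n 0 V 2 0 _ _ _ loc0) _ => //.
(* [V] is also the value of [n] exact steps from the initial law, so the first term vanishes. *)
by rewrite lee_fin /V RE// subrr normr0 mulr0 !add0r.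
Qed.

End ParticleSystem.

(** * A summable solution of the forgetting recursion *)

Section DecaySequence.
Context {R : realType}.
Implicit Types tau delta eta M : R.

(** The right side is [1 - r] times the sum of r^0, ..., r^m, each term of which is at least r^m. *)
Lemma linear_geometric_bound (r : R) m : 0 <= r -> r < 1 ->
  m.+1%:R * r ^+ m * (1 - r) <= 1 - r ^+ m.+1.
Proof.
move=> r0 r1; elim: m => [|m IH]; first by rewrite expr0 expr1 !mul1r.
have rm : 0 <= r ^+ m.+1 by exact: exprn_ge0.
have rm1 : r ^+ m.+1 <= 1 by rewrite exprn_ile1// ltW.
have -> : m.+2%:R * r ^+ m.+1 * (1 - r) =
    r * (m.+1%:R * r ^+ m * (1 - r)) + r ^+ m.+1 * (1 - r).
  by rewrite -natr1 exprS; ring.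
have h : r * (m.+1%:R * r ^+ m * (1 - r)) <= r * (1 - r ^+ m.+1).
  exact: ler_wpM2l.
have h2 : 0 <= (1 - r) * (1 - r ^+ m.+1).
  by rewrite mulr_ge0// subr_ge0// ltW.
rewrite [r ^+ m.+2]exprS; lra.
Qed.

Lemma quadratic_geometric_bound tau m : 0 < tau -> tau < 1 ->
  m.+1%:R ^+ 2 * tau ^+ m <= (1 - Num.sqrt tau) ^- 2.
Proof.
move=> tau0 tau1; set r := Num.sqrt tau.
have r0 : 0 <= r by exact: sqrtr_ge0.
have r1 : r < 1 by rewrite -sqrtr1 ltr_sqrt.
have -> : tau ^+ m = (r ^+ m) ^+ 2 by rewrite exprAC sqr_sqrtr// ltW.
have d0 : 0 < 1 - r by rewrite subr_gt0.
rewrite -exprMn -exprVn ler_pXn2r// ?nnegrE.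
- rewrite -[leRHS]mul1r ler_pdivlMr// (le_trans (linear_geometric_bound _ m r0 r1))//.
  by rewrite gerBl exprn_ge0.
- by rewrite mulr_ge0// exprn_ge0.
- by rewrite invr_ge0 ltW.
Qed.

(* The recursion trades the factor [1 - delta] for a backward jump of a fixed
   fraction [m = L / q] of [L], which a quadratic decay absorbs. *)
Lemma quadratic_decay_sequence delta eta tau :
  0 < delta -> delta <= 1 -> 0 <= eta -> 0 < tau -> tau < 1 ->
  exists M, 1 <= M /\ forall L, (0 < L)%N ->
    1 <= M / L.+1%:R ^+ 2 \/
    exists m, (0 < m <= L)%N /\
      (1 - delta) * (M / (L - m).+1%:R ^+ 2) + eta * tau ^+ m <= M / L.+1%:R ^+ 2.
Proof.
move=> delta0 delta1 eta0 tau0 tau1.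
(* [q > 4 / delta] gives (1 - delta) / (1 - 1/q)^2 <= 1 - delta/2: a jump back by L/q uses up only
   half of the contraction. *)
pose q := (Num.truncn (4 / delta)).+1.
have q4 : 4 / delta < q%:R by exact: truncnS_gt.
have qd : 4 < q%:R * delta by rewrite -ltr_pdivrMr.
have q_gt4 : 4 < q%:R :> R.
  by rewrite (lt_le_trans qd)// ler_piMr.
have q0 : 0 < q%:R :> R by exact: lt_trans q_gt4.
pose C := (1 - Num.sqrt tau) ^- 2.
have C0 : 0 <= C by rewrite invr_ge0 sqr_ge0.
(* The first term makes the bound trivial for L < q; the second lets the other half of the
   contraction absorb [eta * tau ^+ m], since L + 1 <= q (m + 1). *)
pose M := q%:R ^+ 2 + 2 * eta * C * q%:R ^+ 2 / delta.
have M2 : 0 <= 2 * eta * C * q%:R ^+ 2 / delta.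
  by rewrite divr_ge0 ?mulr_ge0// ltW.
have Mq : q%:R ^+ 2 <= M by rewrite lerDl.
have M0 : 0 < M by apply: lt_le_trans Mq; rewrite exprn_gt0.
exists M; split.
  by apply: le_trans Mq; rewrite exprn_ege1// ltW// (lt_trans _ q_gt4)// ltr1n.
move=> L L0.
have x0 : 0 < L.+1%:R ^+ 2 :> R by rewrite exprn_gt0.
have [Lq|qL] := ltnP L q.
  left; rewrite ler_pdivlMr// mul1r (le_trans _ Mq)//.
  by rewrite ler_pXn2r ?nnegrE// ler_nat.
right; exists (L %/ q)%N; set m := (L %/ q)%N.
have mL : (m * q <= L)%N by exact: leq_divM.
have Lm : (L.+1 <= q * m.+1)%N by rewrite mulnC ltn_ceil.
split; first by rewrite divn_gt0// qL leq_div.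
set x : R := L.+1%:R; set z : R := (L - m).+1%:R.
have xp : 0 < x by rewrite ltr0n.
have zp : 0 < z by rewrite ltr0n.
have mE : z = x - m%:R.
  by rewrite /z /x -addn1 natrD natrB ?leq_div// -addn1 natrD; ring.
have mx : m%:R * q%:R <= x by rewrite -natrM ler_nat (leq_trans mL).
have zx : x * (1 - q%:R^-1) <= z.
  by rewrite mE mulrBr mulr1 lerD2l lerN2 -ler_pdivlMr// in mx *.
have q1 : 0 < 1 - q%:R^-1 :> R.
  by rewrite subr_gt0 invf_lt1// (lt_trans _ q_gt4)// ltr1n.
have part1 : (1 - delta) * (M / z ^+ 2) <= (1 - delta / 2) * (M / x ^+ 2).
  apply: (@le_trans _ _ ((1 - delta) * (M / (x * (1 - q%:R^-1)) ^+ 2))).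
    rewrite ler_wpM2l ?subr_ge0// ler_wpM2l ?(ltW M0)// lef_pV2 ?posrE.
    - by rewrite ler_pXn2r ?nnegrE ?mulr_ge0// ltW.
    - exact: exprn_gt0.
    - by rewrite exprn_gt0// mulr_gt0.
  have -> : M / (x * (1 - q%:R^-1)) ^+ 2 = (M / x ^+ 2) / (1 - q%:R^-1) ^+ 2.
    by rewrite exprMn invfM mulrA.
  have -> (w : R) : (1 - delta) * (w / (1 - q%:R^-1) ^+ 2) =
      (1 - delta) / (1 - q%:R^-1) ^+ 2 * w by ring.
  rewrite ler_pM2r ?divr_gt0// ler_pdivrMr ?exprn_gt0//.
  have qi : q%:R^-1 <= delta / 4.
    by rewrite -[leLHS]div1r ler_pdivrMr// mulrAC ler_pdivlMr// mul1r mulrC ltW.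
  have qi0 : 0 < q%:R^-1 :> R by rewrite invr_gt0.
  move: qi qi0; set u := q%:R^-1 => qi qi0; nra.
have part2 : eta * tau ^+ m <= delta / 2 * (M / x ^+ 2).
  rewrite mulrA ler_pdivlMr ?exprn_gt0//.
  apply: (@le_trans _ _ (eta * tau ^+ m * (q%:R * m.+1%:R) ^+ 2)).
    rewrite ler_wpM2l ?mulr_ge0 ?exprn_ge0 ?(ltW tau0)//.
    rewrite ler_pXn2r ?nnegrE ?mulr_ge0 ?(ltW xp) ?(ltW q0)//.
    by rewrite -natrM ler_nat.
  have -> : eta * tau ^+ m * (q%:R * m.+1%:R) ^+ 2 =
      eta * q%:R ^+ 2 * (m.+1%:R ^+ 2 * tau ^+ m) by ring.
  apply: (@le_trans _ _ (eta * q%:R ^+ 2 * C)).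
    by rewrite ler_wpM2l ?mulr_ge0 ?exprn_ge0 ?(ltW q0)// quadratic_geometric_bound.
  have -> : eta * q%:R ^+ 2 * C = delta / 2 * (2 * eta * C * q%:R ^+ 2 / delta).
    by field; rewrite gt_eqF.
  by rewrite ler_wpM2l ?divr_ge0 ?(ltW delta0)// lerDr exprn_ge0// ltW.
by apply: le_trans (lerD part1 part2) _; rewrite -mulrDl subrK mul1r.
Qed.

Lemma sum_inv_squares_le n : \sum_(i < n) (i.+1%:R ^- 2 : R) <= 2.
Proof.
(* The sharper bound telescopes, as 1/(a + 1)^2 <= 1/a - 1/(a + 1). *)
suff h : \sum_(i < n.+1) (i.+1%:R ^- 2 : R) <= 2 - n.+1%:R^-1.
  have : \sum_(i < n) (i.+1%:R ^- 2 : R) <= \sum_(i < n.+1) (i.+1%:R ^- 2 : R).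
    by rewrite big_ord_recr/= lerDl invr_ge0 exprn_ge0.
  move=> /le_trans; apply; apply: le_trans h _.
  by rewrite gerBl invr_ge0.
elim: n => [|n IH]; first by rewrite big_ord1 expr1n invr1; lra.
rewrite big_ord_recr/=; apply: le_trans (lerD IH (lexx _)) _.
have a0 : 0 < n.+1%:R :> R by rewrite ltr0n.
rewrite -[n.+2%:R]natr1; set a : R := n.+1%:R in a0 *.
have -> : 2 - a^-1 + (a + 1) ^- 2 = 2 - (a + 1)^-1 - (a * (a + 1) ^+ 2)^-1.
  by field; rewrite !gt_eqF// addr_gt0.
by rewrite gerBl invr_ge0 mulr_ge0 ?exprn_ge0 ?addr_ge0 ?(ltW a0).
Qed.

Lemma sum_lagged_inv_squares_le M n p : 0 <= M ->
  \sum_(i < n) M / (i - p).+1%:R ^+ 2 <= M * (p%:R + 2).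
Proof.
move=> M0; elim: p n => [|p IH] [|n].
- by rewrite big_ord0 mulr_ge0.
- rewrite add0r -mulr_sumr ler_wpM2l//.
  under eq_bigr do rewrite subn0.
  exact: sum_inv_squares_le.
- by rewrite big_ord0 mulr_ge0// addr_ge0.
rewrite big_ord_recl sub0n expr1n invr1 mulr1.
under eq_bigr do rewrite subSS.
apply: le_trans (lerD (lexx _) (IH n)) _.
by rewrite -natr1; lra.
Qed.

End DecaySequence.

(** * The Kalman filter *)

Section Gaussian.
Context {R : realType}.
Implicit Types m P W h x z : R.

Lemma normal_pdf_sqrtE m P x : 0 < P ->
  normal_pdf m (Num.sqrt P) x =
  (Num.sqrt (P * pi *+ 2))^-1 * expR (- (x - m) ^+ 2 / (P *+ 2)).
Proof.
move=> P0; rewrite normal_pdfE; last by rewrite gt_eqF// sqrtr_gt0.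
by rewrite /normal_peak /normal_fun sqr_sqrtr// ltW.
Qed.

Lemma normal_pdf_sqrt_gt0 m P x : 0 < P -> 0 < normal_pdf m (Num.sqrt P) x.
Proof.
move=> P0; rewrite normal_pdf_sqrtE// mulr_gt0 ?expR_gt0// invr_gt0 sqrtr_gt0.
by rewrite mulrn_wgt0// mulr_gt0// pi_gt0.
Qed.

Lemma normal_pdf_bayes m P h W x z : 0 < P -> 0 < W ->
  let S := h ^+ 2 * P + W in
  normal_pdf m (Num.sqrt P) z * normal_pdf (h * z) (Num.sqrt W) x =
  normal_pdf (h * m) (Num.sqrt S) x *
  normal_pdf ((m * W + h * P * x) / S) (Num.sqrt (P * W / S)) z.
Proof.
move=> P0 W0 S.
have S0 : 0 < S by rewrite ltr_wpDl// mulr_ge0 ?sqr_ge0// ltW.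
have V0 : 0 < P * W / S by rewrite divr_gt0// mulr_gt0.
rewrite !normal_pdf_sqrtE// mulrACA [RHS]mulrACA -!expRD -!invfM.
have p0 (a : R) : 0 <= a -> 0 <= a * pi *+ 2.
  by move=> a0; rewrite mulrn_wge0// mulr_ge0// pi_ge0.
rewrite -!sqrtrM ?p0 ?(ltW P0) ?(ltW S0)//.
congr ((Num.sqrt _)^-1 * expR _).
  by field; rewrite gt_eqF.
rewrite /S in S0 *; field.
by rewrite !gt_eqF.
Qed.

Lemma Rintegral_normal_pdf_bayes m P h W x : 0 < P -> 0 < W ->
  (\int[@lebesgue_measure R]_z
     (normal_pdf m (Num.sqrt P) z * normal_pdf (h * z) (Num.sqrt W) x))%R =
  normal_pdf (h * m) (Num.sqrt (h ^+ 2 * P + W)) x.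
Proof.
move=> P0 W0; under eq_Rintegral do rewrite normal_pdf_bayes//.
rewrite RintegralZl//; last exact: integrable_normal_pdf.
by rewrite /Rintegral integral_normal_pdf mulr1.
Qed.

Lemma integrable_normal_pdf_bayes m P h W x : 0 < P -> 0 < W ->
  (@lebesgue_measure R).-integrable setT (EFin \o (fun z =>
     normal_pdf m (Num.sqrt P) z * normal_pdf (h * z) (Num.sqrt W) x)).
Proof.
move=> P0 W0; set S := h ^+ 2 * P + W.
have -> : EFin \o (fun z =>
     normal_pdf m (Num.sqrt P) z * normal_pdf (h * z) (Num.sqrt W) x) =
   (fun z => (normal_pdf (h * m) (Num.sqrt S) x)%:E *
     (normal_pdf ((m * W + h * P * x) / S) (Num.sqrt (P * W / S)) z)%:E)%E.
  by apply/funext => z /=; rewrite normal_pdf_bayes.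
by apply: integrableZl => //; exact: integrable_normal_pdf.
Qed.

End Gaussian.

Section KalmanFilter.
Context {R : realType} {E : Type}.
Variables (h v w : E -> R) (y : nat -> R) (l : nat -> E).
Hypothesis v_gt0 : forall x, 0 < v x.
Hypothesis w_gt0 : forall x, 0 < w x.

Local Notation c := (kalman_c h v w l).
Local Notation mk := (kalman_m h v w y l).

(* The predictive variance of [X_n.+1] given [Y_1, ..., Y_n]. *)
Definition prior_var n := h (l n.+1) ^+ 2 * c n + w (l n.+1).

(** The posterior variance as prior times noise over their sum. Simplifying the recursion requires a
    nonzero denominator, so nonnegativity is proved in the same induction. *)
Lemma kalman_cS n : c n.+1 =
  prior_var n * v (l n.+1) / (prior_var n + v (l n.+1)) /\ 0 <= c n.
Proof.
elim: n => [|n [IH c_ge0]].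
  split => //; rewrite /= /a_step /sigma2_step /prior_var /= mulr0 !add0r.
  by field; rewrite gt_eqF// addr_gt0.
have P0 : 0 < prior_var n by exact: (ltr_wpDl (mulr_ge0 (sqr_ge0 _) c_ge0)).
have cS0 : 0 <= c n.+1.
  by rewrite IH ltW// divr_gt0 ?mulr_gt0// addr_gt0.
split => //; have P1 : 0 < prior_var n.+1.
  exact: (ltr_wpDl (mulr_ge0 (sqr_ge0 _) cS0)).
have -> : c n.+2 = h (l n.+2) ^+ 2 * c n.+1 + w (l n.+2)
    - a_step h v w l (c n.+1) n.+2 ^+ 2 * sigma2_step h v w l (c n.+1) n.+2 by [].
move: P1; rewrite /a_step /sigma2_step /prior_var.
set u := _ * c n.+1; set W := w _; set V := v _ => P1.
have e : u + V + W = u + W + V by ring.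
by rewrite e; field; rewrite gt_eqF// addr_gt0// /V.
Qed.

Lemma kalman_c_ge0 n : 0 <= c n.
Proof. by have [_] := kalman_cS n. Qed.

Lemma prior_var_gt0 n : 0 < prior_var n.
Proof. exact: (ltr_wpDl (mulr_ge0 (sqr_ge0 _) (kalman_c_ge0 n))). Qed.

Lemma kalman_sigma2S n : kalman_sigma2 h v w l n.+1 = prior_var n + v (l n.+1).
Proof. by rewrite /kalman_sigma2 /sigma2_step /prior_var /=; ring. Qed.

Lemma kalman_aS n :
  kalman_a h v w l n.+1 = prior_var n / (prior_var n + v (l n.+1)).
Proof. by rewrite -kalman_sigma2S. Qed.

(** Correctness of the filter: the joint density factors into the density of the observations and
    the Gaussian prediction of the next state. *)
Lemma prediction_densityE n :
  (forall x, prediction_density h v w y l n x =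
     observation_density h v w y l n *
     normal_pdf (h (l n.+1) * mk n) (Num.sqrt (prior_var n)) x) /\
  observation_density h v w y l n.+1 = observation_density h v w y l n *
    normal_pdf (kalman_mu h v w y l n.+1)
      (Num.sqrt (kalman_sigma2 h v w l n.+1)) (y n.+1).
Proof.
have obsS k : (forall x, prediction_density h v w y l k x =
     observation_density h v w y l k *
     normal_pdf (h (l k.+1) * mk k) (Num.sqrt (prior_var k)) x) ->
  observation_density h v w y l k.+1 = observation_density h v w y l k *
    normal_pdf (kalman_mu h v w y l k.+1)
      (Num.sqrt (kalman_sigma2 h v w l k.+1)) (y k.+1).
  move=> predE; rewrite [LHS]/=.
  under eq_Rintegral => z _ do rewrite predE -mulrA -[in normal_pdf z _ _](mul1r z).
  rewrite RintegralZl//.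
    rewrite Rintegral_normal_pdf_bayes ?prior_var_gt0//.
    by rewrite expr1n !mul1r kalman_sigma2S.
  by apply: integrable_normal_pdf_bayes => //; exact: prior_var_gt0.
elim: n => [|n [predE obsE]].
  have pred0 x : prediction_density h v w y l 0 x =
      observation_density h v w y l 0 *
      normal_pdf (h (l 1%N) * mk 0) (Num.sqrt (prior_var 0)) x.
    by rewrite /= mul1r /prior_var /= !mulr0 add0r.
  by split => //; exact: obsS.
have predS x : prediction_density h v w y l n.+1 x =
     observation_density h v w y l n.+1 *
     normal_pdf (h (l n.+2) * mk n.+1) (Num.sqrt (prior_var n.+1)) x.
  have P0 := prior_var_gt0 n.
  have c0 : 0 < c n.+1.
    by rewrite (kalman_cS n).1 divr_gt0 ?mulr_gt0// addr_gt0.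
  have e z : prediction_density h v w y l n z
       * normal_pdf z (Num.sqrt (v (l n.+1))) (y n.+1)
       * normal_pdf (h (l n.+2) * z) (Num.sqrt (w (l n.+2))) x =
     observation_density h v w y l n.+1 *
      (normal_pdf (mk n.+1) (Num.sqrt (c n.+1)) z *
       normal_pdf (h (l n.+2) * z) (Num.sqrt (w (l n.+2))) x).
    rewrite predE obsE.
    (* Observation update: the posterior mean and variance are [m] and [c] at time [n.+1]. *)
    have := normal_pdf_bayes (h (l n.+1) * mk n) (prior_var n) 1 (v (l n.+1))
      (y n.+1) z P0 (v_gt0 _).
    rewrite /= expr1n !mul1r -kalman_sigma2S => b.
    have cE : prior_var n * v (l n.+1) / kalman_sigma2 h v w l n.+1 = c n.+1.
      by rewrite (kalman_cS n).1 kalman_sigma2S.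
    have mE : (h (l n.+1) * mk n * v (l n.+1) + prior_var n * y n.+1) /
        kalman_sigma2 h v w l n.+1 = mk n.+1.
      rewrite /= kalman_aS kalman_sigma2S; field.
      by rewrite gt_eqF// addr_gt0.
    rewrite cE mE in b.
    have regroup (o A B C D F : R) : A * B = C * D -> o * A * B * F = o * C * (D * F).
      by move=> AB; rewrite -(mulrA o) AB; ring.
    exact: regroup b.
  rewrite [LHS]/=; under eq_Rintegral do rewrite e.
  rewrite RintegralZl//.
    by rewrite Rintegral_normal_pdf_bayes.
  by apply: integrable_normal_pdf_bayes.
by split => //; exact: obsS.
Qed.

Lemma observation_density_gt0 n : 0 < observation_density h v w y l n.
Proof.
elim: n => [|n IH]; first exact: ltr01.
rewrite (prediction_densityE n).2 mulr_gt0// normal_pdf_sqrt_gt0//.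
by rewrite kalman_sigma2S addr_gt0// prior_var_gt0.
Qed.

Lemma observation_density_ratio n :
  observation_density h v w y l n.+1 / observation_density h v w y l n =
  normal_pdf (kalman_mu h v w y l n.+1)
    (Num.sqrt (kalman_sigma2 h v w l n.+1)) (y n.+1).
Proof.
rewrite (prediction_densityE n).2 mulrAC divff ?mul1r//.
by rewrite gt_eqF// observation_density_gt0.
Qed.

End KalmanFilter.

Lemma window_last k n : (1 <= k <= n)%N -> (n - k + 1 <= n <= n)%N.
Proof. lia. Qed.

Lemma window_pred k n i : (1 <= k <= n)%N ->
  (n.-1 - k.-1 + 1 <= i <= n.-1)%N -> (n - k + 1 <= i <= n)%N.
Proof. lia. Qed.

Lemma window_nth S k i : (k < S)%N -> (S.-1 - k + 1 <= i <= S.-1)%N ->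
  (S - k <= i < S)%N.
Proof. lia. Qed.

(** * Uniform bounds and exponential forgetting for the Kalman recursion *)

Section KalmanBounds.
Context {R : realType} {E : Type}.
Variables (h v w : E -> R) (hbar vlow vbar wlow wbar : R).
Hypothesis vlow_gt0 : 0 < vlow.
Hypothesis v_bounds : forall x, vlow <= v x <= vbar.
Hypothesis wlow_gt0 : 0 < wlow.
Hypothesis w_bounds : forall x, wlow <= w x <= wbar.
Hypothesis hbar_lt1 : hbar < 1.
Hypothesis h_bounds : forall x, `|h x| <= hbar.

Let v_gt0 x : 0 < v x.
Proof. by case/andP: (v_bounds x) => + _; exact: lt_le_trans. Qed.

Let w_gt0 x : 0 < w x.
Proof. by case/andP: (w_bounds x) => + _; exact: lt_le_trans. Qed.

Lemma h_sqr_le x : h x ^+ 2 <= hbar ^+ 2.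
Proof.
rewrite -[leLHS]real_normK ?num_real// ler_pXn2r// nnegrE//.
exact: le_trans (h_bounds x).
Qed.

(** A posterior variance is at most the noise of the observation just made; at time 0 there is
    none. *)
Lemma kalman_c_le l n : kalman_c h v w l n <= vbar \/ n = 0%N.
Proof.
case: n => [|n]; [by right|left].
rewrite (kalman_cS h v w l v_gt0 w_gt0 n).1.
have P0 := prior_var_gt0 h v w l v_gt0 w_gt0 n.
have := v_bounds (l n.+1) => /andP[_]; apply: le_trans.
set P := prior_var _ _ _ _ _ in P0 *; set V := v _.
have V0 : 0 < V by exact: v_gt0.
have PV : 0 < P + V by exact: addr_gt0.
by rewrite ler_pdivrMr// mulrC ler_pM2l// lerDl ltW.
Qed.

Lemma kalman_c_bounds l n : 0 <= kalman_c h v w l n <= vbar.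
Proof.
rewrite (kalman_c_ge0 h v w l v_gt0 w_gt0)/=.
have [//|->] := kalman_c_le l n.
have /andP[h1 h2] := v_bounds (l 0%N).
by rewrite ltW// (lt_le_trans _ h2)// (lt_le_trans vlow_gt0).
Qed.

(** The observation update does not expand distances between prior variances, and the prediction
    multiplies distances by h^2. *)
Lemma kalman_c_forget l l' k n : (k <= n)%N ->
  (forall i, (n - k + 1 <= i <= n)%N -> l i = l' i) ->
  `|kalman_c h v w l n - kalman_c h v w l' n| <= (hbar ^+ 2) ^+ k * vbar.
Proof.
elim: k n => [|k IH] n kn ll'.
  have /andP[a1 a2] := kalman_c_bounds l n.
  have /andP[b1 b2] := kalman_c_bounds l' n.
  by rewrite expr0 mul1r ler_norml; lra.
case: n => // n in kn ll' *.
have {}IH := IH n kn (fun i hi => ll' i ltac:(lia)).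
rewrite !(kalman_cS h v w _ v_gt0 w_gt0 n).1.
have P0 := prior_var_gt0 h v w l v_gt0 w_gt0 n.
have P'0 := prior_var_gt0 h v w l' v_gt0 w_gt0 n.
have e : l n.+1 = l' n.+1 by apply: ll'; lia.
have PP' : prior_var h v w l n - prior_var h v w l' n =
    h (l' n.+1) ^+ 2 * (kalman_c h v w l n - kalman_c h v w l' n).
  by rewrite /prior_var e; ring.
rewrite e; set V := v (l' n.+1); set P := prior_var h v w l n in P0 PP' *.
set P' := prior_var h v w l' n in P'0 PP' *.
have V0 : 0 < V by exact: v_gt0.
(* Exact difference quotient of the update; both factors in front lie in [0, 1]. *)
have -> : P * V / (P + V) - P' * V / (P' + V) =
    (V / (P + V)) * (V / (P' + V)) * (P - P').
  by field; rewrite !gt_eqF// addr_gt0.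
have f1 (Z : R) : 0 < Z -> 0 <= V / (Z + V) <= 1.
  move=> Z0; have ZV : 0 < Z + V by rewrite addr_gt0.
  by rewrite divr_ge0 ?(ltW V0) ?(ltW ZV)//= ler_pdivrMr// mul1r lerDr ltW.
have /andP[a0 a1] := f1 P P0; have /andP[b0 b1] := f1 P' P'0.
rewrite PP' normrM (ger0_norm (mulr_ge0 a0 b0)) normrM (ger0_norm (sqr_ge0 _)).
rewrite -[leRHS]mul1r; apply: ler_pM.
- exact: mulr_ge0.
- by rewrite mulr_ge0 ?sqr_ge0.
- exact: mulr_ile1.
- rewrite (exprS (hbar ^+ 2)) -(mulrA (hbar ^+ 2)).
  by apply: ler_pM => //; [exact: sqr_ge0|exact: h_sqr_le].
Qed.

Variables (y : nat -> R) (Cy : R).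
Hypothesis y_le : forall n, (1 <= n)%N -> `|y n| <= Cy.

Let Cy_ge0 : 0 <= Cy.
Proof. exact: le_trans (y_le 1%N isT). Qed.

Lemma kalman_m_le l n : `|kalman_m h v w y l n| <= Cy.
Proof.
elim: n => [|n IH]; first by rewrite normr0.
rewrite /= kalman_aS.
have P0 := prior_var_gt0 h v w l v_gt0 w_gt0 n.
set P := prior_var _ _ _ _ _ in P0 *; set V := v _.
have V0 : 0 < V by exact: v_gt0.
have PV : 0 < P + V by exact: addr_gt0.
set a := P / (P + V); set m := kalman_m _ _ _ _ _ n in IH *.
have a0 : 0 <= a by rewrite divr_ge0 ?ltW.
have a1 : a <= 1 by rewrite ler_pdivrMr// mul1r lerDl ltW.
clearbody a.
(* A convex combination of two numbers bounded by [Cy]. *)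
have -> : h (l n.+1) * m + a * (y n.+1 - h (l n.+1) * m) =
    (1 - a) * (h (l n.+1) * m) + a * y n.+1 by ring.
rewrite (le_trans (ler_normD _ _))// !normrM (ger0_norm a0).
rewrite (ger0_norm (_ : 0 <= 1 - a)) ?subr_ge0//.
have hm : `|h (l n.+1)| * `|m| <= Cy.
  rewrite -[leRHS]mul1r ler_pM//.
  exact: le_trans (h_bounds _) (ltW hbar_lt1).
have -> : Cy = (1 - a) * Cy + a * Cy by ring.
by rewrite lerD ?ler_wpM2l ?subr_ge0// y_le.
Qed.

Lemma kalman_mu_le l n : `|kalman_mu h v w y l n| <= Cy.
Proof.
rewrite normrM -[leRHS]mul1r ler_pM ?kalman_m_le//.
exact: le_trans (h_bounds _) (ltW hbar_lt1).
Qed.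

Lemma kalman_innovation_le l n : (1 <= n)%N ->
  `|y n - kalman_mu h v w y l n| <= 2 * Cy.
Proof.
move=> n1; rewrite (le_trans (ler_normB _ _))//.
by have := y_le n n1; have := kalman_mu_le l n; lra.
Qed.

Lemma kalman_sigma2_bounds l n :
  vlow + wlow <= kalman_sigma2 h v w l n <= 2 * vbar + wbar.
Proof.
rewrite /kalman_sigma2 /sigma2_step.
have /andP[v1 v2] := v_bounds (l n); have /andP[w1 w2] := w_bounds (l n).
have /andP[c0 c1] := kalman_c_bounds l n.-1.
have hc0 : 0 <= h (l n) ^+ 2 * kalman_c h v w l n.-1 by rewrite mulr_ge0 ?sqr_ge0.
have hc1 : h (l n) ^+ 2 * kalman_c h v w l n.-1 <= vbar.
  rewrite -[leRHS]mul1r ler_pM ?sqr_ge0// -[leLHS]real_normK ?num_real//.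
  by rewrite exprn_ile1// (le_trans (h_bounds _))// ltW.
lra.
Qed.

Let lo2 := vlow + wlow.
Let hi2 := 2 * vbar + wbar.

Let lo2_gt0 : 0 < lo2. Proof. exact: addr_gt0. Qed.

(** Largest variance in the peak, smallest in the exponent, and an innovation of size [2 * Cy]. *)
Definition density_low : R :=
  (Num.sqrt (hi2 * pi *+ 2))^-1 * expR (- ((2 * Cy) ^+ 2 / (lo2 *+ 2))).

Definition density_high : R := (Num.sqrt (lo2 * pi *+ 2))^-1.

Definition innovation_density l n : R :=
  normal_pdf (kalman_mu h v w y l n) (Num.sqrt (kalman_sigma2 h v w l n)) (y n).

Lemma density_low_gt0 : 0 < hi2 -> 0 < density_low.
Proof.
move=> hi0; rewrite mulr_gt0 ?expR_gt0// invr_gt0 sqrtr_gt0.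
by rewrite mulrn_wgt0// mulr_gt0// pi_gt0.
Qed.

Lemma innovation_density_bounds l n : (1 <= n)%N ->
  density_low <= innovation_density l n <= density_high.
Proof.
move=> n1; have /andP[s1 s2] := kalman_sigma2_bounds l n.
rewrite -/lo2 -/hi2 in s1 s2.
rewrite /innovation_density; set s := kalman_sigma2 _ _ _ _ _ in s1 s2 *.
have s0 : 0 < s := lt_le_trans lo2_gt0 s1.
have i0 := kalman_innovation_le l n n1.
rewrite normal_pdf_sqrtE// /density_low /density_high.
have p2 (r : R) : 0 < r -> 0 < Num.sqrt (r * pi *+ 2).
  by move=> r0; rewrite sqrtr_gt0 mulrn_wgt0// mulr_gt0// pi_gt0.
have pm (r r' : R) : 0 < r -> r <= r' ->
    (Num.sqrt (r' * pi *+ 2))^-1 <= (Num.sqrt (r * pi *+ 2))^-1.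
  move=> r0 rr'; have r'0 := lt_le_trans r0 rr'.
  rewrite lef_pV2 ?posrE ?p2// ler_wsqrtr// ler_wMn2r//.
  by rewrite ler_wpM2r// pi_ge0.
apply/andP; split.
  apply: ler_pM; rewrite ?expR_ge0 ?invr_ge0 ?sqrtr_ge0 ?pm//.
  rewrite ler_expR mulNr lerN2; apply: ler_pM.
  - exact: sqr_ge0.
  - by rewrite invr_ge0 mulrn_wge0// ltW.
  - by rewrite -[leLHS]real_normK ?num_real// ler_pXn2r ?nnegrE// mulr_ge0.
  - by rewrite lef_pV2 ?posrE ?mulrn_wgt0// ler_wMn2r.
rewrite -[leRHS]mulr1; apply: ler_pM; rewrite ?expR_ge0 ?invr_ge0 ?sqrtr_ge0 ?pm//.
rewrite -expR0 ler_expR mulNr oppr_le0 divr_ge0 ?sqr_ge0// mulrn_wge0//.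
exact: ltW.
Qed.

Variables (tau Cmu : R).
Hypothesis hbar_tau : hbar <= tau.
Hypothesis Cmu_gt0 : 0 < Cmu.
Hypothesis mu_forget : forall (k n : nat) (l l' : nat -> E), (1 <= k <= n)%N ->
  (forall i, (n - k + 1 <= i <= n)%N -> l i = l' i) ->
  `|kalman_mu h v w y l n - kalman_mu h v w y l' n|
    <= Cmu * \big[Num.max/0]_(1 <= i < n) `|y i| * tau ^+ k.

(** The terms come from the variance in the peak, the mean in the exponent and the variance in the
    exponent. *)
Definition density_rate : R :=
  vbar / lo2 + Cmu * Cy * (2 * Cy) / lo2 + (2 * Cy) ^+ 2 * vbar / (2 * lo2 ^+ 2).

Lemma innovation_density_forget k n l l' : (1 <= k <= n)%N ->
  (forall i, (n - k + 1 <= i <= n)%N -> l i = l' i) ->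
  innovation_density l n <= expR (density_rate * tau ^+ k) * innovation_density l' n.
Proof.
move=> /andP[k1 kn] ll'.
have n1 : (1 <= n)%N := leq_trans k1 kn.
have hbar0 : 0 <= hbar by exact: le_trans (h_bounds (l 0%N)).
have tau0 : 0 <= tau := le_trans hbar0 hbar_tau.
have tk0 : 0 <= tau ^+ k by exact: exprn_ge0.
have vbar0 : 0 <= vbar.
  by have /andP[a b] := kalman_c_bounds l 0; exact: le_trans b.
have kn' : (1 <= k <= n)%N by rewrite k1.
have lnn : l n = l' n by apply: ll'; exact: window_last.
have muB : `|kalman_mu h v w y l n - kalman_mu h v w y l' n| <= Cmu * Cy * tau ^+ k.
  apply: le_trans (mu_forget k n l l' _ ll') _; first by rewrite k1.
  rewrite ler_wpM2r// ler_wpM2l ?(ltW Cmu_gt0)//.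
  rewrite big_nat; elim/big_ind: _ => //.
    by move=> a b a1 b1; rewrite ge_max a1.
  by move=> i /andP[i1 _]; exact: y_le.
(* Coordinate [n] enters [sigma2_step] directly, leaving [k.-1] shared coordinates for the variance
   at time [n.-1]; the factor h^2 restores the exponent [k], and hbar^2 <= tau. *)
have sB : `|kalman_sigma2 h v w l n - kalman_sigma2 h v w l' n| <= vbar * tau ^+ k.
  rewrite /kalman_sigma2 /sigma2_step lnn.
  set c1 := kalman_c h v w l n.-1; set c2 := kalman_c h v w l' n.-1.
  have -> : h (l' n) ^+ 2 * c1 + v (l' n) + w (l' n) -
    (h (l' n) ^+ 2 * c2 + v (l' n) + w (l' n)) = h (l' n) ^+ 2 * (c1 - c2) by ring.
  have := kalman_c_forget l l' k.-1 n.-1.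
  rewrite -/c1 -/c2 => cB0.
  have cB := cB0 ltac:(by rewrite -!subn1 leq_sub2r) (fun i hi => ll' i (window_pred k n i kn' hi)).
  rewrite normrM (ger0_norm (sqr_ge0 _)).
  apply: le_trans (ler_pM (sqr_ge0 _) (normr_ge0 _) (h_sqr_le _) cB) _.
  rewrite mulrA -exprS prednK// mulrC ler_wpM2l//.
  rewrite ler_pXn2r ?nnegrE ?sqr_ge0// expr2.
  by rewrite -[leRHS]mul1r ler_pM// ltW.
have /andP[s1 _] := kalman_sigma2_bounds l n.
have /andP[s'1 _] := kalman_sigma2_bounds l' n.
rewrite -/lo2 in s1 s'1.
have i1 := kalman_innovation_le l n n1; have i2 := kalman_innovation_le l' n n1.
rewrite /innovation_density.
set s := kalman_sigma2 h v w l n in sB s1 *.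
set s' := kalman_sigma2 h v w l' n in sB s'1 *.
set mu := kalman_mu h v w y l n in muB i1 *.
set mu' := kalman_mu h v w y l' n in muB i2 *.
have s0 : 0 < s := lt_le_trans lo2_gt0 s1.
have s'0 : 0 < s' := lt_le_trans lo2_gt0 s'1.
rewrite !normal_pdf_sqrtE//.
have p2 (r : R) : 0 < r -> 0 < Num.sqrt (r * pi *+ 2).
  by move=> r0; rewrite sqrtr_gt0 mulrn_wgt0// mulr_gt0// pi_gt0.
set D1 := vbar / lo2 * tau ^+ k.
have D10 : 0 <= D1 by rewrite mulr_ge0// divr_ge0// ltW.
have peak : (Num.sqrt (s * pi *+ 2))^-1 <= expR D1 * (Num.sqrt (s' * pi *+ 2))^-1.
  rewrite ler_pdivlMr ?p2// mulrC ler_pdivrMr ?p2//.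
  have -> : expR D1 = Num.sqrt (expR D1 ^+ 2) by rewrite sqrtr_sqr ger0_norm ?expR_ge0.
  rewrite -sqrtrM ?sqr_ge0// ler_wsqrtr// -mulrnAr -[s * pi *+ 2]mulrnAr mulrA.
  have pi2 : 0 <= pi *+ 2 :> R by apply: mulrn_wge0; exact: pi_ge0.
  apply: (ler_wpM2r pi2).
  have : s' <= expR D1 * s.
    apply: (@le_trans _ _ ((1 + D1) * s)); last first.
      by rewrite ler_wpM2r ?expR_ge1Dx// ltW.
    rewrite mulrDl mul1r -lerBlDl.
    apply: (@le_trans _ _ (vbar * tau ^+ k)).
      by move: sB; rewrite distrC => /(le_trans (ler_norm _)).
    have -> : D1 * s = vbar * tau ^+ k * (s / lo2) by rewrite /D1; ring.
    by rewrite ler_peMr ?mulr_ge0// ler_pdivlMr// mul1r.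
  move=> /le_trans; apply; rewrite ler_wpM2r ?(ltW s0)// expr2.
  by rewrite ler_peMl ?expR_ge0// -expR0 ler_expR.
have expo : - (y n - mu) ^+ 2 / (s *+ 2) <=
    (Cmu * Cy * (2 * Cy) / lo2 + (2 * Cy) ^+ 2 * vbar / (2 * lo2 ^+ 2)) * tau ^+ k
    - (y n - mu') ^+ 2 / (s' *+ 2).
  set a := y n - mu in i1 *; set b := y n - mu' in i2 *.
  have ab : a - b = - (mu - mu') by rewrite /a /b; ring.
  (* The mean is changed at fixed variance [s'], then the variance at fixed innovation [a]. *)
  have -> : - a ^+ 2 / (s *+ 2) = - b ^+ 2 / (s' *+ 2)
     + (b - a) * (a + b) / (s' *+ 2) + a ^+ 2 * (s - s') / (2 * (s * s')).
    by field; rewrite !gt_eqF.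
  have hX : (b - a) * (a + b) / (s' *+ 2) <= Cmu * Cy * (2 * Cy) / lo2 * tau ^+ k.
    apply: le_trans (ler_norm _) _.
    rewrite normrM normrM distrC ab normrN normfV.
    rewrite (ger0_norm (_ : 0 <= s' *+ 2)); last by rewrite mulrn_wge0 ?ltW.
    have hab : `|a + b| <= 4 * Cy.
      by rewrite (le_trans (ler_normD _ _))//; lra.
    apply: (@le_trans _ _ (Cmu * Cy * tau ^+ k * (4 * Cy) / (lo2 *+ 2))).
      apply: ler_pM; rewrite ?mulr_ge0 ?invr_ge0 ?mulrn_wge0 ?(ltW s'0)//.
        by apply: ler_pM.
      by rewrite lef_pV2 ?posrE ?mulrn_wgt0// ler_wMn2r.
    by rewrite le_eqVlt; apply/orP; left; apply/eqP; field; rewrite gt_eqF.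
  have hY : a ^+ 2 * (s - s') / (2 * (s * s')) <=
      (2 * Cy) ^+ 2 * vbar / (2 * lo2 ^+ 2) * tau ^+ k.
   apply: le_trans (ler_norm _) _.
   rewrite normrM normrM (ger0_norm (sqr_ge0 _)) normfV.
   rewrite (ger0_norm (_ : 0 <= 2 * (s * s'))); last by rewrite !mulr_ge0 ?ltW.
   have a2 : a ^+ 2 <= (2 * Cy) ^+ 2.
     by rewrite -[leLHS]real_normK ?num_real// ler_pXn2r ?nnegrE// mulr_ge0.
   apply: (@le_trans _ _ ((2 * Cy) ^+ 2 * (vbar * tau ^+ k) / (2 * lo2 ^+ 2))).
     apply: ler_pM.
     - by rewrite mulr_ge0 ?sqr_ge0.
     - by rewrite invr_ge0 !mulr_ge0 ?(ltW s0) ?(ltW s'0).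
     - by apply: ler_pM => //; exact: sqr_ge0.
     - rewrite lef_pV2 ?posrE ?mulr_gt0// expr2 ler_pM2l//.
       by apply: ler_pM => //; exact: ltW.
   by rewrite le_eqVlt; apply/orP; left; apply/eqP; ring.
  by rewrite [in leRHS]mulrDl mulNr -addrA addrC lerD2r lerD.
have e2 : expR (density_rate * tau ^+ k) = expR D1 * expR
    ((Cmu * Cy * (2 * Cy) / lo2 + (2 * Cy) ^+ 2 * vbar / (2 * lo2 ^+ 2)) * tau ^+ k).
  by rewrite -expRD /density_rate /D1; congr expR; ring.
rewrite e2 mulrACA; apply: ler_pM; rewrite ?invr_ge0 ?sqrtr_ge0 ?expR_ge0//.
by rewrite -expRD ler_expR (mulNr ((y n - mu') ^+ 2)).
Qed.

End KalmanBounds.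

Lemma density_rate_ge0 {R : realType} (vlow vbar wlow Cy Cmu : R) :
  0 < vlow -> 0 < wlow -> 0 <= vbar -> 0 <= Cy -> 0 <= Cmu ->
  0 <= density_rate vlow vbar wlow Cy Cmu.
Proof.
move=> vl wl vb cy cm; have l0 : 0 <= vlow + wlow by rewrite addr_ge0 ?ltW.
rewrite /density_rate; apply: addr_ge0; first apply: addr_ge0.
- exact: divr_ge0.
- by rewrite divr_ge0// !mulr_ge0.
- by rewrite divr_ge0// mulr_ge0 ?sqr_ge0.
Qed.

(** * The potential of a path and the choice of the lag *)

Section KalmanPathPotential.
Context {R : realType} {d} {E : measurableType d}.
Variables (x0 : E) (h v w : E -> R) (hbar vlow vbar wlow wbar : R).
Hypotheses (mh : measurable_fun setT h) (mv : measurable_fun setT v)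
  (mw : measurable_fun setT w).
Hypothesis vlow_gt0 : 0 < vlow.
Hypothesis v_bounds : forall x, vlow <= v x <= vbar.
Hypothesis wlow_gt0 : 0 < wlow.
Hypothesis w_bounds : forall x, wlow <= w x <= wbar.
Hypothesis hbar_lt1 : hbar < 1.
Hypothesis h_bounds : forall x, `|h x| <= hbar.
Variables (y : nat -> R) (Cy : R).
Hypothesis y_le : forall n, (1 <= n)%N -> `|y n| <= Cy.

Let v_gt0 x : 0 < v x.
Proof. by case/andP: (v_bounds x) => + _; exact: lt_le_trans. Qed.

Let w_gt0 x : 0 < w x.
Proof. by case/andP: (w_bounds x) => + _; exact: lt_le_trans. Qed.

Section Trajectories.
Context {d'} {T : measurableType d'}.
Variable L : T -> nat -> E.
Hypothesis mL : forall k, measurable_fun setT (L ^~ k).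

Let bh k : bdd_mfun (fun t => h (L t k)).
Proof.
by apply: (bdd_mfun_comp h (L ^~ k)) => //; split => //; exists hbar.
Qed.

Let bv k : bdd_mfun (fun t => v (L t k)).
Proof.
apply: (bdd_mfun_comp v (L ^~ k)) => //; split => //; exists vbar => x.
by rewrite gtr0_norm//; case/andP: (v_bounds x).
Qed.

Let bw k : bdd_mfun (fun t => w (L t k)).
Proof.
apply: (bdd_mfun_comp w (L ^~ k)) => //; split => //; exists wbar => x.
by rewrite gtr0_norm//; case/andP: (w_bounds x).
Qed.

Let prior_bdd k : bdd_mfun (fun t => kalman_c h v w (L t) k) ->
  bdd_mfun (fun t => prior_var h v w (L t) k).
Proof.
move=> bc; apply: bdd_mfunD => //; apply: bdd_mfunM => //.
by under eq_fun do rewrite expr2; exact: bdd_mfunM.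
Qed.

Let inverse_bdd k : bdd_mfun (fun t => kalman_c h v w (L t) k) ->
  bdd_mfun (fun t => (prior_var h v w (L t) k + v (L t k.+1))^-1).
Proof.
move=> bc; apply: (bdd_mfunV vlow) => //.
  move=> t; have /andP[v1 _] := v_bounds (L t k.+1); apply: (le_trans v1).
  by rewrite lerDr; exact/ltW/prior_var_gt0.
by apply: bdd_mfunD => //; exact: prior_bdd.
Qed.

Lemma kalman_c_bdd k : bdd_mfun (fun t => kalman_c h v w (L t) k).
Proof.
elim: k => [|k IH]; first exact: bdd_mfun_cst.
have -> : (fun t => kalman_c h v w (L t) k.+1) = (fun t =>
    prior_var h v w (L t) k * v (L t k.+1) *
    (prior_var h v w (L t) k + v (L t k.+1))^-1).
  by apply/funext => t; rewrite (kalman_cS h v w (L t) v_gt0 w_gt0 k).1.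
apply: bdd_mfunM; last exact: inverse_bdd.
by apply: bdd_mfunM => //; exact: prior_bdd.
Qed.

Lemma kalman_m_bdd k : bdd_mfun (fun t => kalman_m h v w y (L t) k).
Proof.
elim: k => [|k IH]; first exact: bdd_mfun_cst.
have bP := prior_bdd k (kalman_c_bdd k).
have bI := inverse_bdd k (kalman_c_bdd k).
have -> : (fun t => kalman_m h v w y (L t) k.+1) = (fun t =>
    h (L t k.+1) * kalman_m h v w y (L t) k +
    (prior_var h v w (L t) k * (prior_var h v w (L t) k + v (L t k.+1))^-1) *
    (y k.+1 - h (L t k.+1) * kalman_m h v w y (L t) k)).
  by apply/funext => t; rewrite /= kalman_aS.
have bhm := bdd_mfunM _ _ (bh k.+1) IH.
apply: bdd_mfunD => //; apply: bdd_mfunM; first exact: bdd_mfunM.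
by apply: bdd_mfunB => //; exact: bdd_mfun_cst.
Qed.

Lemma measurable_innovation_density k :
  measurable_fun setT (fun t => innovation_density h v w y (L t) k.+1).
Proof.
pose s t := prior_var h v w (L t) k + v (L t k.+1).
have s0 t : 0 < s t by rewrite addr_gt0// prior_var_gt0.
have bs : bdd_mfun s by apply: bdd_mfunD => //; exact/prior_bdd/kalman_c_bdd.
have bI : bdd_mfun (fun t => (s t)^-1) by exact/inverse_bdd/kalman_c_bdd.
pose e t := y k.+1 - h (L t k.+1) * kalman_m h v w y (L t) k.
have be : bdd_mfun e.
  apply: bdd_mfunB; first exact: bdd_mfun_cst.
  by apply: bdd_mfunM => //; exact: kalman_m_bdd.
(* The Gaussian density is rewritten as a constant, a power and an exponential, each visibly
   measurable. *)
have -> : (fun t => innovation_density h v w y (L t) k.+1) = (fun t =>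
    Num.sqrt (pi *+ 2)^-1 * ((s t)^-1 `^ 2^-1) *
    expR (- 2^-1 * (e t * e t * (s t)^-1))).
  apply/funext => t.
  rewrite /innovation_density (kalman_sigma2S h v w (L t) k).
  rewrite normal_pdf_sqrtE; last exact: s0.
  rewrite -/(s t) powR12_sqrt; last by rewrite invr_ge0 ltW.
  rewrite -sqrtrM; last by rewrite invr_ge0 mulrn_wge0// pi_ge0.
  rewrite -invfM sqrtrV; last by rewrite mulr_ge0 ?(ltW (s0 t))// mulrn_wge0// pi_ge0.
  congr ((Num.sqrt _)^-1 * expR _).
    by rewrite -mulrnAr mulrC.
  by rewrite /e /kalman_mu/=; field; rewrite gt_eqF.
apply: measurable_funM.
  apply: measurable_funM => //.
  apply: (@measurableT_comp _ _ _ _ _ _ (@powR R ^~ 2^-1) _ (fun t => (s t)^-1)).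
    exact: measurable_powR.
  exact: bI.1.
apply: measurableT_comp; first exact: measurable_expR.
by apply: measurable_funM => //; exact: (bdd_mfunM _ _ (bdd_mfunM _ _ be be) bI).1.
Qed.

End Trajectories.

(** The default value is the head of the path, to match [potential]; [x0] appears only for the empty
    path. *)
Definition trajectory (s : seq E) : nat -> E := nth (head x0 s) s.

Lemma measurable_trajectory n k :
  measurable_fun setT (fun t : n.+1.-tuple E => trajectory t k).
Proof.
have [kn|nk] := ltnP k n.+1.
  have -> : (fun t : n.+1.-tuple E => trajectory t k) =
      (@tnth _ E ^~ (Ordinal kn)).
    by apply/funext => t; rewrite /trajectory (tnth_nth (head x0 t)).
  exact: measurable_tnth.
have -> : (fun t : n.+1.-tuple E => trajectory t k) = (@tnth _ E ^~ ord0).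
  apply/funext => t; rewrite /trajectory nth_default ?size_tuple//.
  by rewrite (tnth_nth x0) nth0.
exact: measurable_tnth.
Qed.

Let low := density_low vlow vbar wlow wbar Cy.
Let high := density_high (R := R) vlow wlow.

(* On paths of length one the potential plays no role; any constant will do. *)
Definition path_potential (s : seq E) : R :=
  if (size s <= 1)%N then low
  else innovation_density h v w y (trajectory s) (size s).-1.

Let innov_bounds l n : (1 <= n)%N ->
  low <= innovation_density h v w y l n <= high.
Proof.
move=> n1; exact: (innovation_density_bounds h v w hbar vlow vbar wlow wbar
  vlow_gt0 v_bounds wlow_gt0 w_bounds hbar_lt1 h_bounds y Cy y_le).
Qed.

Lemma path_potential_bounds s : low <= path_potential s <= high.
Proof.
rewrite /path_potential; case: ifPn => [_|]; last first.
  by case: (size s) => [//|[//|n _]]; exact: innov_bounds.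
by have /andP[a b] := innov_bounds (trajectory s) 1 isT; rewrite lexx (le_trans a b).
Qed.

Hypothesis low_gt0 : 0 < low.

Lemma path_potential_path : path_mfun path_potential.
Proof.
split=> [[|n]|].
- rewrite (_ : (fun _ => _) = (fun=> low)); first exact: measurable_cst.
  by apply/funext => t; rewrite /path_potential size_tuple.
- rewrite (_ : (fun _ => _) = (fun t : n.+2.-tuple E =>
      innovation_density h v w y (trajectory t) n.+1)).
    apply: (measurable_innovation_density (fun t : n.+2.-tuple E => trajectory t)).
    by move=> k; exact: measurable_trajectory.
  by apply/funext => t; rewrite /path_potential size_tuple.
exists high => s; have /andP[a b] := path_potential_bounds s.
by rewrite ger0_norm// (le_trans (ltW low_gt0)).
Qed.

Lemma potential_path n (t : n.+2.-tuple E) :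
  potential h v w y n.+1 t = path_potential t.
Proof.
rewrite /potential /path_potential size_tuple /=.
have -> : nth (thead t) t = trajectory t.
  by rewrite /trajectory /thead (tnth_nth x0) nth0.
exact: (observation_density_ratio h v w y _ v_gt0 w_gt0 n).
Qed.

Variables (tau Cmu : R).
Hypothesis hbar_tau : hbar <= tau.
Hypothesis Cmu_gt0 : 0 < Cmu.
Hypothesis mu_forget : forall (k n : nat) (l l' : nat -> E), (1 <= k <= n)%N ->
  (forall i, (n - k + 1 <= i <= n)%N -> l i = l' i) ->
  `|kalman_mu h v w y l n - kalman_mu h v w y l' n|
    <= Cmu * \big[Num.max/0]_(1 <= i < n) `|y i| * tau ^+ k.

Let rate := density_rate vlow vbar wlow Cy Cmu.
Hypothesis rate_ge0 : 0 <= rate.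
Hypothesis tau_ge0 : 0 <= tau.

(** Paths of length at most [j] that agree are equal. Otherwise the last [j] entries are the
    coordinates n - j + 1, ..., n with n = size s - 1, exactly the window of the filter estimate. *)
Lemma path_potential_agree j s t : (0 < j)%N -> agree j s t ->
  path_potential s <= expR (rate * tau ^+ j) * path_potential t.
Proof.
move=> j0 st; have e1 : 1 <= expR (rate * tau ^+ j).
  by rewrite -expR0 ler_expR mulr_ge0// exprn_ge0.
have pt0 : 0 <= path_potential t.
  by have /andP[a _] := path_potential_bounds t; exact: le_trans (ltW low_gt0) a.
have [sj|js] := leqP (size s) j.
  by rewrite (agree_full j s t sj st) ler_peMl.
have ss : size s = size t by case: st.
rewrite /path_potential -ss; case: ifPn => [_|]; first by rewrite ler_peMl// ltW.
rewrite -ltnNge => s1.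
apply: (innovation_density_forget h v w hbar vlow vbar wlow wbar
  vlow_gt0 v_bounds wlow_gt0 w_bounds hbar_lt1 h_bounds y Cy y_le tau Cmu
  hbar_tau Cmu_gt0 mu_forget).
  by rewrite j0/= -ltnS prednK// (ltn_trans _ s1).
move=> i /(window_nth _ _ _ js)/andP[ji i_s]; rewrite /trajectory.
by rewrite (agree_nth (head x0 s) j s t i st ji); apply: set_nth_default; rewrite -ss.
Qed.

End KalmanPathPotential.

(** * The constants of the statement and the growth of the lag *)

Section Constants.
Context {R : realType}.
Variables hbar vlow vbar wlow wbar Cy Cmu : R.
Hypotheses (hbar_ge0 : 0 <= hbar) (hbar_lt1 : hbar < 1).
Hypotheses (vlow_gt0 : 0 < vlow) (v_le : vlow <= vbar).
Hypotheses (wlow_gt0 : 0 < wlow) (w_le : wlow <= wbar).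

Local Notation tau := (tau hbar vbar wlow).
Local Notation c := (c_const hbar vlow vbar wlow wbar Cy).

Lemma tau_bounds : [/\ 0 < tau, tau < 1 & hbar <= tau].
Proof.
have vb : 0 < vbar := lt_le_trans vlow_gt0 v_le.
have ts : 0 < tau_sigma vbar wlow < 1.
  have wv : 0 < wlow / vbar by exact: divr_gt0.
  have den : 1 < 1 + wlow / vbar
       + 2 * Num.sqrt (wlow / vbar + wlow ^+ 2 / vbar ^+ 2).
    by rewrite -addrA ltrDl ltr_wpDr// mulr_ge0// sqrtr_ge0.
  have den0 := lt_trans ltr01 den.
  by rewrite /tau_sigma div1r invr_gt0 den0 invf_lt1.
case/andP: ts => ts0 ts1; rewrite /Defs.tau; split.
- by rewrite lt_max ts0 orbT.
- by rewrite gt_max hbar_lt1.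
- by rewrite le_max lexx.
Qed.

Lemma c_const_ge1 : 1 <= c.
Proof.
have vb : 0 < vbar := lt_le_trans vlow_gt0 v_le.
rewrite /c_const -[leLHS]mulr1; apply: ler_pM => //.
  rewrite ler_pdivlMr ?mul1r; last by rewrite sqrtr_gt0 addr_gt0.
  rewrite ler_wsqrtr// lerD// (le_trans v_le)// mulrDl mul1r lerDr.
  by rewrite mulr_ge0 ?exprn_ge0// ltW.
rewrite -expR0 ler_expR mulr_ge0 ?divr_ge0 ?sqr_ge0//.
by rewrite addr_ge0 ?sqr_ge0.
Qed.

Lemma ln_tau_lt0 : ln tau < 0.
Proof. by have [t0 t1 _] := tau_bounds; by rewrite ln_lt0// t0. Qed.

(** The logarithm splits into a constant and that of the square root of N, crudely bounded by ln N;
    the ceiling adds 1. *)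
Lemma lag_le : exists a b : R, 0 < a /\ 0 <= b /\
  forall N, (0 < N)%N ->
    (lag hbar vlow vbar wlow wbar Cy Cmu N)%:R <= a * ln N%:R + b.
Proof.
have lt0 := ln_tau_lt0; set T := - ln tau.
have T0 : 0 < T by rewrite oppr_gt0.
set ph := phi hbar vlow vbar wlow wbar Cy Cmu.
pose A := `|ln (4 * c / (3 * ph))|.
have A0 : 0 <= A by exact: normr_ge0.
exists (T^-1), (A / T + 1); split; first by rewrite invr_gt0.
split; first by rewrite addr_ge0// divr_ge0// ltW.
move=> N N0; rewrite /lag -/ph.
have N1 : 1 <= N%:R :> R by rewrite ler1n.
have lnN : 0 <= ln N%:R :> R by exact: ln_ge0.
set X := ln _ / ln tau.
have absX : `|X| <= T^-1 * ln N%:R + A / T.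
  rewrite /X normrM normfV (ltr0_norm lt0) -/T.
  rewrite ler_pdivrMr//.
  have -> : (T^-1 * ln N%:R + A / T) * T = A + ln N%:R by field; rewrite gt_eqF.
  (* For [ph <= 0] the argument of the logarithm is nonpositive, where [ln] is 0 by convention. *)
  have [ph0|ph0] := leP ph 0.
    have c4 : 0 <= 4 * c by rewrite mulr_ge0// (le_trans ler01 c_const_ge1).
    have d0 : 3 * ph * Num.sqrt N%:R <= 0.
      by apply: mulr_le0_ge0; [exact: mulr_ge0_le0|exact: sqrtr_ge0].
    rewrite ln0; first by rewrite normr0 addr_ge0.
    by apply: mulr_ge0_le0; rewrite ?invr_le0.
  have sN : 0 < Num.sqrt N%:R :> R by rewrite sqrtr_gt0 (lt_le_trans ltr01).
  have c0 : 0 < c := lt_le_trans ltr01 c_const_ge1.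
  have -> : 4 * c / (3 * ph * Num.sqrt N%:R) = 4 * c / (3 * ph) * (Num.sqrt N%:R)^-1.
    by rewrite invfM mulrA.
  have Ap : 0 < 4 * c / (3 * ph).
    by apply: divr_gt0; apply: mulr_gt0.
  rewrite lnM ?posrE ?invr_gt0//.
  rewrite (le_trans (ler_normD _ _))// lerD2l lnV ?posrE// normrN.
  have s1 : 1 <= Num.sqrt N%:R :> R by rewrite -[leLHS]sqrtr1 ler_wsqrtr.
  have N_gt0 : 0 < N%:R :> R by exact: lt_le_trans N1.
  have NE : N%:R = Num.sqrt N%:R * Num.sqrt N%:R :> R.
    by rewrite -expr2 sqr_sqrtr// ltW.
  rewrite ger0_norm ?ln_ge0// ler_ln ?posrE// [leRHS]NE.
  by apply: ler_peMl => //; exact: ltW.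
have ceilX : (absz (Num.max 0 (Num.ceil X)))%:R <= `|X| + 1.
  have [cX|cX] := leP (Num.ceil X) 0.
    by rewrite absz0 addr_ge0.
  rewrite natr_absz ger0_norm; last exact: ltW.
  have := ceilB1_lt X; rewrite intrB ltrBlDr => /ltW/le_trans; apply.
  by rewrite lerD2r ler_norm.
by rewrite (le_trans ceilX)// addrA lerD2r.
Qed.

Lemma exponent_le1 : 1 + 3 * ln c / ln tau <= 1.
Proof.
rewrite gerDl mulr_ge0_le0//; last by rewrite invr_le0 ltW// ln_tau_lt0.
by rewrite mulr_ge0// ln_ge0// c_const_ge1.
Qed.

End Constants.

(** * Assembly of the uniform bound *)

Theorem lemma13 (R : realType) (E : completeMetricType R)
  (E_separable : separable E)
  (zeta : probability (borel E) R) (Q : nat -> R.-pker (borel E) ~> (borel E))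
  (eps : nat -> R)
  (Q_mixing : forall n, (1 <= n)%N -> 0 < eps n < 1 /\
    exists xi : {measure set (borel E) -> \bar R},
      forall (l : borel E) (A : set (borel E)), measurable A ->
        ((eps n)%:E * xi A <= Q n l A <= ((eps n)^-1)%:E * xi A)%E)
  (eps_inf : exists e : R, 0 < e /\ forall n, (1 <= n)%N -> e <= eps n)
  (h v w : {mfun borel E >-> R}) (hbar vlow vbar wlow wbar Cy Cmu : R)
  (v_bounds : 0 < vlow /\ forall l, vlow <= v l <= vbar)
  (w_bounds : 0 < wlow /\ forall l, wlow <= w l <= wbar)
  (h_bounds : hbar < 1 /\ forall l, `|h l| <= hbar)
  (Cmu_gt0 : 0 < Cmu) :
  let tau := tau hbar vbar wlow in
  let c := c_const hbar vlow vbar wlow wbar Cy in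
  tau * c ^+ 3 < 1 ->
  exists C D : R, forall y : nat -> R,
    (forall n, (1 <= n)%N -> `|y n| <= Cy) ->
    (forall (k n : nat) (l l' : nat -> borel E), (1 <= k <= n)%N ->
      (forall i, (n - k + 1 <= i <= n)%N -> l i = l' i) ->
      `|kalman_mu h v w y l n - kalman_mu h v w y l' n|
        <= Cmu * \big[Num.max/0]_(1 <= i < n) `|y i| * tau ^+ k) ->
    forall n N : nat, (1 <= N)%N ->
      let p := lag hbar vlow vbar wlow wbar Cy Cmu N in
      (particle_error zeta Q (potential h v w y) N n p
       <= (C * (ln N%:R + D)
           * ((Num.sqrt N%:R)^-1 `^ (1 + 3 * ln c / ln tau)))%:E)%E.
Proof.
move=> tau c _.
(* A negative [Cy] admits no observation sequence, as [y 1] shows. *)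
have [Cy_lt0|Cy_ge0] := ltP Cy 0.
  exists 0, 0 => y /(_ 1%N isT) y1.
  by have := le_lt_trans (le_trans (normr_ge0 _) y1) Cy_lt0; rewrite ltxx.
case: v_bounds => vlow_gt0 v_bd; case: w_bounds => wlow_gt0 w_bd.
case: h_bounds => hbar_lt1 h_bd.
pose x0 : borel E := point.
have hbar_ge0 : 0 <= hbar := le_trans (normr_ge0 _) (h_bd x0).
have v_le : vlow <= vbar by case/andP: (v_bd x0) => /le_trans; apply.
have w_le : wlow <= wbar by case/andP: (w_bd x0) => /le_trans; apply.
have vbar_gt0 := lt_le_trans vlow_gt0 v_le.
have [tau_gt0 tau_lt1 hbar_tau] :=
  tau_bounds hbar vlow vbar wlow hbar_lt1 vlow_gt0 v_le wlow_gt0.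
rewrite -/tau in tau_gt0 tau_lt1 hbar_tau.
case: eps_inf => e [e_gt0 e_le].
have e_lt1 : e < 1.
  by have [/andP[_ e1] _] := Q_mixing 1%N isT; exact: le_lt_trans (e_le 1%N isT) e1.
(* Passing from one kernel to [xi] and back to another costs one inverse of [eps n] each way; the
   uniform lower bound [e] removes the dependence on time. *)
pose kap := (e ^+ 2)^-1.
have kap_ge1 : 1 <= kap.
  by rewrite invf_ge1 ?exprn_gt0// exprn_ile1// ltW.
have Q_compare n l l' A : (0 < n)%N -> measurable A ->
    (Q n l A <= kap%:E * Q n l' A)%E.
  move=> n_gt0 mA; have [/andP[en0 en1] [xi xiQ]] := Q_mixing n n_gt0.
  have /andP[_ h1] := xiQ l A mA; have /andP[h2 _] := xiQ l' A mA.
  apply: le_trans h1 _.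
  have -> : (((eps n)^-1)%:E * xi A = ((eps n ^+ 2)^-1)%:E * ((eps n)%:E * xi A))%E.
    rewrite muleA -EFinM; congr (_%:E * _)%E.
    by rewrite expr2 invfM mulfVK// gt_eqF.
  apply: (@le_trans _ _ (((eps n ^+ 2)^-1)%:E * Q n l' A)%E).
    by apply: lee_wpmul2l h2; rewrite lee_fin invr_ge0 sqr_ge0.
  apply: lee_wpmul2r => //; rewrite lee_fin lef_pV2 ?posrE ?exprn_gt0//.
  by rewrite ler_pXn2r ?nnegrE ?(ltW e_gt0) ?(ltW en0)// e_le.
pose lo := density_low vlow vbar wlow wbar Cy.
pose hi := density_high (R := R) vlow wlow.
pose K := density_rate vlow vbar wlow Cy Cmu.
have lo_gt0 : 0 < lo.
  apply: density_low_gt0; rewrite addr_gt0 ?mulr_gt0//.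
  exact: lt_le_trans w_le.
have K_ge0 : 0 <= K by apply: density_rate_ge0 => //; exact: ltW.
have mr0 : 0 <= memory_rate K tau by exact: memory_rate_ge0.
have fc1 : 1 <= forget_const K tau kap.
  have e1 : 1 <= expR (memory_rate K tau) by rewrite -expR0 ler_expR.
  rewrite /forget_const -[leLHS]mulr1; apply: ler_pM => //.
  by rewrite exprn_ege1// -[leLHS]mulr1; apply: ler_pM.
have fc0 := lt_le_trans ltr01 fc1.
have [M [M_ge1 M_rec]] := quadratic_decay_sequence (forget_const K tau kap)^-1
  (2 * memory_rate K tau) tau ltac:(by rewrite invr_gt0) ltac:(by rewrite invf_le1)
  ltac:(by rewrite mulr_ge0) tau_gt0 tau_lt1.
have M_ge0 : 0 <= M := le_trans ler01 M_ge1.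
pose b L := M / L.+1%:R ^+ 2.
have b_ge0 L : 0 <= b L by rewrite divr_ge0// exprn_ge0.
have b0_ge1 : 1 <= b 0%N by rewrite /b expr1n divr1.
have [a [a' [a_gt0 [a'_ge0 lag_bound]]]] :=
  lag_le hbar vlow vbar wlow wbar Cy Cmu hbar_ge0 hbar_lt1 vlow_gt0 v_le wlow_gt0 w_le.
pose W := weight_ratio lo hi K tau kap.
(* Chosen before [y], which enters only through [Cy] and [Cmu]. The constant D turns the bound a ln
   N + a' + 2 on p + 2 into a (ln N + D). *)
exists (2 * W ^+ 2 * M * a), ((a' + 2) / a) => y y_le mu_forget n N N_gt0.
cbv zeta; set p := lag _ _ _ _ _ _ _ N.
have Psi_bounds s := path_potential_bounds x0 h v w hbar vlow vbar wlow wbar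
  vlow_gt0 v_bd wlow_gt0 w_bd hbar_lt1 h_bd y Cy y_le s.
have Psi_path := path_potential_path x0 h v w hbar vlow vbar wlow wbar
  (measurable_funP h) (measurable_funP v) (measurable_funP w)
  vlow_gt0 v_bd wlow_gt0 w_bd hbar_lt1 h_bd y Cy y_le lo_gt0.
have Psi_agree := path_potential_agree x0 h v w hbar vlow vbar wlow wbar
  vlow_gt0 v_bd wlow_gt0 w_bd hbar_lt1 h_bd y Cy y_le lo_gt0 tau Cmu
  hbar_tau Cmu_gt0 mu_forget K_ge0 (ltW tau_gt0).
have PsiTE := potential_path x0 h v w vlow vbar wlow wbar
  vlow_gt0 v_bd wlow_gt0 w_bd y Cy.
apply: le_trans (particle_error_le x0 Q _ zeta _ PsiTE Psi_path lo hi lo_gt0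
  Psi_bounds K tau kap K_ge0 tau_gt0 tau_lt1 kap_ge1 Psi_agree Q_compare b
  b0_ge1 M_rec b_ge0 N n p N_gt0) _.
rewrite lee_fin /local_error.
have N1 : 1 <= N%:R :> R by rewrite ler1n.
have sN : 0 < Num.sqrt N%:R :> R by rewrite sqrtr_gt0 (lt_le_trans ltr01).
set x := (Num.sqrt N%:R)^-1.
have x_gt0 : 0 < x by rewrite invr_gt0.
have x_le1 : x <= 1 by rewrite invf_le1// -[leLHS]sqrtr1 ler_wsqrtr.
rewrite -mulr_suml -mulr_sumr -/W -/x.
have sum_le : \sum_(i < n) b (i - p)%N <= M * (p%:R + 2).
  exact: sum_lagged_inv_squares_le.
(* For a base at most 1, an exponent at most 1 can only increase the power. *)
have x_pow : x <= x `^ (1 + 3 * ln c / ln tau).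
  rewrite -[leLHS]powRr1 ?(ltW x_gt0)//; apply: ger_powR; first by rewrite x_gt0.
  exact: exponent_le1.
have lnN : 0 <= ln N%:R :> R by exact: ln_ge0.
have p_le : p%:R + 2 <= a * (ln N%:R + (a' + 2) / a).
  have -> : a * (ln N%:R + (a' + 2) / a) = a * ln N%:R + a' + 2.
    by field; rewrite gt_eqF.
  rewrite lerD2r.
  exact: lag_bound.
have -> : 2 * W ^+ 2 * M * a * (ln N%:R + (a' + 2) / a) *
    x `^ (1 + 3 * ln c / ln tau) =
  2 * (W ^+ 2 * (M * (a * (ln N%:R + (a' + 2) / a))) *
    x `^ (1 + 3 * ln c / ln tau)) by ring.
rewrite ler_pM2l//; apply: ler_pM => //.
- by rewrite mulr_ge0 ?sqr_ge0// sumr_ge0.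
- exact: ltW.
apply: ler_wpM2l; first exact: sqr_ge0.
by apply: le_trans sum_le _; apply: ler_wpM2l.
Qed.
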